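(* Suppose Assumption A1 and Assumption A2(ii) hold, and that the minimum in the definition of $\mathrm{Regret}_T$ (over $\mathcal U(\kappa,\gamma)$) is attained. Let $K$ be $(\kappa,\gamma)$-strongly stable. Then for every $T\ge 3$ and every $\delta\in(0,1]$, Algorithm DAP-OGD run with constant learning rate $\eta_t\equiv (\sqrt T(\log T)^3)^{-1}$ satisfies, with probability at least $1-\delta$, $$\mathrm{Regret}_T\le\Big(\frac{2\sqrt3\,G_c C_\delta^3}{\sqrt\gamma}+\frac{D^2}{2}\Big)\sqrt T(\log T)^3+\frac{C_\delta}{2}\sqrt T\log T+6G_cC_\delta^2(\log T)^2,$$ where $D:=\frac{4\kappa_B\kappa^3\sqrt n}{\gamma}$, $C_\delta:=\frac{65724\,\sigma_w^{[1,4]} n^2G_c^2\kappa_B^6\kappa^{18}}{\delta\gamma^8(1-\gamma)^4}$, and $\sigma_w^{[1,4]}:=\max\{\sigma_w,\sigma_w^4\}$.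
   Context: Linear system $x_{t+1}=Ax_t+Bu_t+w_t$, $t\ge 0$, with $x_0=0$, $x_t,w_t\in\mathbb R^{n_x}$, $u_t\in\mathbb R^{n_u}$, $A,B$ known; $n:=\max\{n_x,n_u\}$, $\kappa_B:=\max\{\|B\|,1\}$; $\|\cdot\|$ is the spectral/Euclidean norm, $\|\cdot\|_F$ the Frobenius norm, $\log$ natural log. $\{w_t\}$ is a stochastic noise process (not assumed i.i.d.); convention $w_s:=0$ for $s<0$. Cost functions $c_t:\mathbb R^{n_x}\times\mathbb R^{n_u}\to\mathbb R$, $t=0,\dots,T-1$, fixed in advance; $c_t$ is revealed only after $u_t$ is chosen. $J_T(\{u_t\})=\sum_{t=0}^{T-1}c_t(x_t,u_t)$. Strong stability: for $\kappa\ge1,\gamma\in(0,1)$, $K\in\mathbb R^{n_u\times n_x}$ is $(\kappa,\gamma)$-strongly stable if there are complex matrices $P,Q$ with $A-BK=QPQ^{-1}$, $\|P\|\le1-\gamma$, $\|K\|,\|Q\|,\|Q^{-1}\|\le\kappa$. $\mathcal K(\kappa,\gamma)$ is the set of such $K$; $\mathcal U(\kappa,\gamma)$ is the set of input sequences $u_t=-K'x_t$ ($t\in[0,T-1]$) for some $K'\in\mathcal K(\kappa,\gamma)$, driven by the same noise realization. $\mathrm{Regret}_T:=J_T(\{u_t\})-\min_{\{u^*_t\}\in\mathcal U(\kappa,\gamma)}J_T(\{u_t^*\})$. Assumption A1: each $c_t$ is convex and differentiable, and there is $G_c\ge1$ with $\|\nabla_xc_t(x,u)\|\le G_c\|x\|$,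 $\|\nabla_uc_t(x,u)\|\le G_c\|u\|$ for all $x,u,t$. Assumption A2: (i) $\mathbb E\|w_t\|\le\sigma_w$ for all $t$; (ii) $\mathbb E\|w_t\|^4\le\sigma_w^4$ for all $t$ (for some $\sigma_w\ge0$). Parameters: $H:=\lceil 2\gamma^{-1}\log T\rceil$; $M=\{M^{[0]},\dots,M^{[H-1]}\}$, $M^{[i]}\in\mathbb R^{n_u\times n_x}$, with $\|M\|_F:=\|[M^{[0]},\dots,M^{[H-1]}]\|_F$; $\mathcal M:=\{M:\|M^{[i]}\|\le2\kappa_B\kappa^3(1-\gamma)^i,\ i=0,\dots,H-1\}$. $A_K:=A-BK$. Surrogate cost: $\Psi^{K,h}_{t,i}(M_{t-h:t}):=A_K^i\mathbf 1_{i\le h}+\sum_{j=0}^hA_K^jBM_{t-j}^{[i-j-1]}\mathbf 1_{i-j\in[1,H]}$; $y_t(M_{t-1-H:t-1}):=\sum_{i=0}^{2H}\Psi^{K,H}_{t-1,i}(M_{t-1-H:t-1})w_{t-1-i}$; $v_t(M_{t-1-H:t}):=-Ky_t+\sum_{i=1}^HM_t^{[i-1]}w_{t-i}$; $F_t(M_{t-1-H:t}):=c_t(y_t,v_t)$ and $f_t(M):=F_t(M,\dots,M)$. Algorithm DAP-OGD (inputs $\kappa,\gamma$, learning rates $\eta_t$, a $(\kappa,\gamma)$-strongly stable $K$, $M_0\in\mathcal M$): for $t=0,\dots,T-1$: apply $u_t=-Kx_t+\sum_{i=1}^HM_t^{[i-1]}w_{t-i}$; observe $c_t$, pay $c_t(x_t,u_t)$;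 observe $x_{t+1}$ and set $w_t=x_{t+1}-Ax_t-Bu_t$; update $M_{t+1}=\Pi_{\mathcal M}(M_t-\eta_t\nabla_Mf_t(M_t))$, where $\Pi_{\mathcal M}$ is the Frobenius-norm projection onto $\mathcal M$. *)

(* Defs.v *)
From HB Require Import structures.
From mathcomp Require Import all_boot all_order all_algebra.
From mathcomp Require Import all_classical all_reals all_analysis.
From mathcomp Require Import complex.
Set Implicit Arguments. Unset Strict Implicit. Unset Printing Implicit Defensive.
Import Order.TTheory GRing.Theory Num.Theory.
Import numFieldNormedType.Exports.
Local Open Scope classical_set_scope.
Local Open Scope ring_scope.

Definition vnorm {R : realType} {m : nat} (x : 'cV[R]_m) : R :=
  Num.sqrt (\sum_(i < m) x i 0 ^+ 2).

Definition frobn {R : realType} {m n : nat} (M : 'M[R]_(m, n)) : R :=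
  Num.sqrt (\sum_(i < m) \sum_(j < n) M i j ^+ 2).

Definition specnorm {R : realType} {m n : nat} (M : 'M[R]_(m, n)) : R :=
  sup [set vnorm (M *m x) | x in [set x : 'cV[R]_n | vnorm x <= 1]].

Definition cvnorm {R : realType} {m : nat} (z : 'cV[R[i]]_m) : R :=
  Num.sqrt (\sum_(i < m) ((@complex.Re R (z i 0)) ^+ 2 + (@complex.Im R (z i 0)) ^+ 2)).

Definition specnormC {R : realType} {m n : nat} (M : 'M[R[i]]_(m, n)) : R :=
  sup [set cvnorm (M *m z) | z in [set z : 'cV[R[i]]_n | cvnorm z <= 1]].

Definition toC {R : realType} (r : R) : R[i] := @Complex R r 0.

(* matrix power (valid also for 0x0 matrices) *)
Definition mxpow {R : realType} {n : nat} (M : 'M[R]_n) (k : nat) : 'M[R]_n :=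
  iter k (mulmx M) 1%:M.

Definition strongly_stable {R : realType} {nx nu : nat}
  (A : 'M[R]_nx) (B : 'M[R]_(nx, nu)) (kappa gamma : R) (K : 'M[R]_(nu, nx)) : Prop :=
  exists P Q : 'M[R[i]]_nx,
    [/\ Q \in unitmx,
        map_mx toC (A - B *m K) = Q *m P *m invmx Q,
        specnormC P <= 1 - gamma,
        specnorm K <= kappa &
        (specnormC Q <= kappa /\ specnormC (invmx Q) <= kappa)].

Definition kappaB {R : realType} {nx nu : nat} (B : 'M[R]_(nx, nu)) : R :=
  Num.max (specnorm B) 1.

Definition grad {R : realType} {m n : nat} (g : 'M[R]_(m, n) -> R)
  (X : 'M[R]_(m, n)) : 'M[R]_(m, n) :=
  \matrix_(i < m, j < n) ('d g X (delta_mx i j)).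

Definition gradx {R : realType} {nx nu : nat}
  (c : nat -> 'cV[R]_nx -> 'cV[R]_nu -> R) t x u : 'cV[R]_nx :=
  grad (fun x' => c t x' u) x.

Definition gradu {R : realType} {nx nu : nat}
  (c : nat -> 'cV[R]_nx -> 'cV[R]_nu -> R) t x u : 'cV[R]_nu :=
  grad (fun u' => c t x u') u.

Definition assumption_A1 {R : realType} {nx nu : nat}
  (c : nat -> 'cV[R]_nx -> 'cV[R]_nu -> R) (Gc : R) : Prop :=
  [/\ 1 <= Gc,
      (forall t x1 u1 x2 u2 (l : R), 0 <= l <= 1 ->
         c t (l *: x1 + (1 - l) *: x2) (l *: u1 + (1 - l) *: u2)
           <= l * c t x1 u1 + (1 - l) * c t x2 u2),
      (forall t (x : 'cV[R]_nx) (u : 'cV[R]_nu),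
         differentiable (fun p : 'cV[R]_nx * 'cV[R]_nu => c t p.1 p.2) (x, u)) &
      (forall t x u, vnorm (gradx c t x u) <= Gc * vnorm x /\
                     vnorm (gradu c t x u) <= Gc * vnorm u)].

Definition Hpar {R : realType} (T : nat) (gamma : R) : nat :=
  `|Num.ceil (2 * gamma^-1 * ln (T%:R : R))|%N.

(* A parameter M = {M^[0], ..., M^[H-1]} is stored as the block row
   [M^[0], ..., M^[H-1]] : 'M_(nu, H * nx); blk M k = M^[k]. *)
Definition blk {R : realType} {nu nx H : nat} (M : 'M[R]_(nu, H * nx)) (k : nat)
  : 'M[R]_(nu, nx) :=
  \matrix_(a < nu, b < nx)
    match (insub k : option 'I_H) with
    | Some i => M a (mxvec_index i b)
    | None => 0
    end.

Definition inM {R : realType} {nx nu : nat} (B : 'M[R]_(nx, nu)) (kappa gamma : R)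
  (H : nat) (M : 'M[R]_(nu, H * nx)) : Prop :=
  forall k : 'I_H, specnorm (blk M k) <= 2 * kappaB B * kappa ^+ 3 * (1 - gamma) ^+ k.

(* Frobenius-norm projection onto \mathcal M (the unique minimizer) *)
Definition projM {R : realType} {nx nu : nat} (B : 'M[R]_(nx, nu)) (kappa gamma : R)
  (H : nat) (X : 'M[R]_(nu, H * nx)) : 'M[R]_(nu, H * nx) :=
  xget 0 [set Y | inM B kappa gamma Y /\
                  forall Z, inM B kappa gamma Z -> frobn (X - Y) <= frobn (X - Z)].

Definition wz {R : realType} {nx : nat} (w : nat -> 'cV[R]_nx) (s : int) : 'cV[R]_nx :=
  match s with Posz k => w k | Negz _ => 0 end.

(* Psi^{K,h}_{t,i}(M_{t-h:t}); Ms gives M_s for each time s *)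
Definition Psi {R : realType} {nx nu : nat} (A : 'M[R]_nx) (B : 'M[R]_(nx, nu))
  (K : 'M[R]_(nu, nx)) (H h : nat) (Ms : int -> 'M[R]_(nu, H * nx)) (t : int) (i : nat)
  : 'M[R]_nx :=
  (if (i <= h)%N then mxpow (A - B *m K) i else 0)
  + \sum_(j < h.+1)
      (if ((j < i)%N && (i - j <= H)%N)
       then mxpow (A - B *m K) j *m B *m blk (Ms (t - j%:Z)) (i - j - 1)
       else 0).

Definition ysur {R : realType} {nx nu : nat} (A : 'M[R]_nx) (B : 'M[R]_(nx, nu))
  (K : 'M[R]_(nu, nx)) (H : nat) (w : nat -> 'cV[R]_nx)
  (Ms : int -> 'M[R]_(nu, H * nx)) (t : int) : 'cV[R]_nx :=
  \sum_(i < (2 * H).+1) Psi A B K H Ms (t - 1) i *m wz w (t - 1 - i%:Z).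

Definition vsur {R : realType} {nx nu : nat} (A : 'M[R]_nx) (B : 'M[R]_(nx, nu))
  (K : 'M[R]_(nu, nx)) (H : nat) (w : nat -> 'cV[R]_nx)
  (Ms : int -> 'M[R]_(nu, H * nx)) (t : int) : 'cV[R]_nu :=
  - (K *m ysur A B K w Ms t)
  + \sum_(i < H) blk (Ms t) i *m wz w (t - (i.+1)%:Z).

Definition Fsur {R : realType} {nx nu : nat} (A : 'M[R]_nx) (B : 'M[R]_(nx, nu))
  (K : 'M[R]_(nu, nx)) (H : nat) (c : nat -> 'cV[R]_nx -> 'cV[R]_nu -> R)
  (w : nat -> 'cV[R]_nx) (t : nat) (Ms : int -> 'M[R]_(nu, H * nx)) : R :=
  c t (ysur A B K w Ms t) (vsur A B K w Ms t).

Definition fsur {R : realType} {nx nu : nat} (A : 'M[R]_nx) (B : 'M[R]_(nx, nu))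
  (K : 'M[R]_(nu, nx)) (H : nat) (c : nat -> 'cV[R]_nx -> 'cV[R]_nu -> R)
  (w : nat -> 'cV[R]_nx) (t : nat) (M : 'M[R]_(nu, H * nx)) : R :=
  Fsur A B K c w t (fun _ => M).

Definition dap_input {R : realType} {nx nu : nat} (K : 'M[R]_(nu, nx)) (H : nat)
  (w : nat -> 'cV[R]_nx) (t : nat) (x : 'cV[R]_nx) (M : 'M[R]_(nu, H * nx))
  : 'cV[R]_nu :=
  - (K *m x) + \sum_(i < H) blk M i *m wz w (t%:Z - (i.+1)%:Z).

Fixpoint dap_state {R : realType} {nx nu : nat} (A : 'M[R]_nx) (B : 'M[R]_(nx, nu))
  (K : 'M[R]_(nu, nx)) (kappa gamma eta : R) (H : nat)
  (c : nat -> 'cV[R]_nx -> 'cV[R]_nu -> R) (w : nat -> 'cV[R]_nx)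
  (M0 : 'M[R]_(nu, H * nx)) (t : nat) : 'cV[R]_nx * 'M[R]_(nu, H * nx) :=
  match t with
  | 0 => (0, M0)
  | t'.+1 =>
      let st := dap_state A B K kappa gamma eta c w M0 t' in
      (A *m st.1 + B *m dap_input K w t' st.1 st.2 + w t',
       projM B kappa gamma (st.2 - eta *: grad (fsur A B K c w t') st.2))
  end.

Definition J_dap {R : realType} {nx nu : nat} (A : 'M[R]_nx) (B : 'M[R]_(nx, nu))
  (K : 'M[R]_(nu, nx)) (kappa gamma eta : R) (H : nat)
  (c : nat -> 'cV[R]_nx -> 'cV[R]_nu -> R) (w : nat -> 'cV[R]_nx)
  (M0 : 'M[R]_(nu, H * nx)) (T : nat) : R :=
  \sum_(t < T)
    (let st := dap_state A B K kappa gamma eta c w M0 t in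
     c t st.1 (dap_input K w t st.1 st.2)).

Fixpoint lin_state {R : realType} {nx nu : nat} (A : 'M[R]_nx) (B : 'M[R]_(nx, nu))
  (K' : 'M[R]_(nu, nx)) (w : nat -> 'cV[R]_nx) (t : nat) : 'cV[R]_nx :=
  match t with
  | 0 => 0
  | t'.+1 => let x := lin_state A B K' w t' in A *m x + B *m (- (K' *m x)) + w t'
  end.

Definition J_lin {R : realType} {nx nu : nat} (A : 'M[R]_nx) (B : 'M[R]_(nx, nu))
  (K' : 'M[R]_(nu, nx)) (c : nat -> 'cV[R]_nx -> 'cV[R]_nu -> R)
  (w : nat -> 'cV[R]_nx) (T : nat) : R :=
  \sum_(t < T) c t (lin_state A B K' w t) (- (K' *m lin_state A B K' w t)).

(* Regret_T = J_T(DAP-OGD) - min over U(kappa, gamma) (written as an infimum;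
   attainment is a hypothesis of the theorem) *)
Definition regret {R : realType} {nx nu : nat} (A : 'M[R]_nx) (B : 'M[R]_(nx, nu))
  (K : 'M[R]_(nu, nx)) (kappa gamma eta : R) (H : nat)
  (c : nat -> 'cV[R]_nx -> 'cV[R]_nu -> R) (w : nat -> 'cV[R]_nx)
  (M0 : 'M[R]_(nu, H * nx)) (T : nat) : R :=
  J_dap A B K kappa gamma eta c w M0 T
  - inf [set J_lin A B K' c w T | K' in [set K' | strongly_stable A B kappa gamma K']].

(** * Constants of the bound (65724 is written 65 * 1000 + 724 to avoid a unary nat literal) *)
Definition Dconst {R : realType} {nx nu : nat} (B : 'M[R]_(nx, nu)) (kappa gamma : R) : R :=
  4 * kappaB B * kappa ^+ 3 * Num.sqrt ((maxn nx nu)%:R) / gamma.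

Definition Cdelta {R : realType} {nx nu : nat} (B : 'M[R]_(nx, nu))
  (kappa gamma Gc sigw delta : R) : R :=
  (65 * 1000 + 724) * Num.max sigw (sigw ^+ 4) * ((maxn nx nu)%:R) ^+ 2 * Gc ^+ 2
    * kappaB B ^+ 6 * kappa ^+ 18
  / (delta * gamma ^+ 8 * (1 - gamma) ^+ 4).

Definition regret_bound {R : realType} {nx nu : nat} (B : 'M[R]_(nx, nu))
  (kappa gamma Gc sigw delta : R) (T : nat) : R :=
  let C := Cdelta B kappa gamma Gc sigw delta in
  let D := Dconst B kappa gamma in
  let lT := ln (T%:R : R) in
  (2 * Num.sqrt 3 * Gc * C ^+ 3 / Num.sqrt gamma + D ^+ 2 / 2)
    * Num.sqrt (T%:R) * lT ^+ 3
  + C / 2 * Num.sqrt (T%:R) * lT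
  + 6 * Gc * C ^+ 2 * lT ^+ 2.

(* Main.v *)
(* With lam = 1 - gamma, strong stability gives |(A - B K)^j| <= kappa^2 lam^j, so
   every state, input and gradient is dominated by iterated exponential filters of
   the sequence |w_t|, and such filters are bounded on l^1 and l^4. The regret
   splits, using convexity of the costs, into
   - the regret of projected gradient descent for the f_t, which produces the term
     D^2 / 2 and a multiple of eta * \sum |grad f_t|^2;
   - the effect F_t - f_t of the drift of the parameters over the memory, of order
     eta * \sum |w|^4 as well;
   - the truncation errors, of order lam^H (\sum |w|)^2 <= T^-2 (\sum |w|)^2, both
     for the algorithm and for the approximation of a linear policy K' by the
     parameter M^[i] = (K - K') (A - B K')^i.
   Hence the regret is controlled pathwise by the single random variable
   \sum_(t < T) |w_t|^4, and Markov's inequality is applied only once, to it. *)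
Require Import Defs.
From HB Require Import structures.
From mathcomp Require Import all_boot all_order all_algebra.
From mathcomp Require Import all_classical all_reals all_analysis.
From mathcomp Require Import complex measurable_realfun.
From mathcomp Require Import ring lra zify.
Set Implicit Arguments. Unset Strict Implicit. Unset Printing Implicit Defensive.
Import Order.TTheory GRing.Theory Num.Theory.
Import numFieldNormedType.Exports.
Local Open Scope classical_set_scope.
Local Open Scope ring_scope.

(** * Frobenius and spectral norms *)

(** A1 bounds gradients only by [Gc] times the norm of the argument, so costs grow quadratically:
    |grad f_t|^2, and the product of a state with the filtered parameter drift, are both of degree
    four in the noise. This is why fourth moments are the natural quantity. Convexity is always
    applied at the point whose norm is already majorized, so a comparison of two costs pays for the
    norm of one of the two points only. The Frobenius geometry of the gradient step is what brings
    in [H]: a parameter acts on the window of the last [H] noise vectors, and the fourth powers of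
    the l^2 norm of that window sum to at most H^2 times \sum |w|^4. Since H <= 3 log T / gamma and
    eta = (sqrt T (log T)^3)^-1, the degree-four terms total eta H T sigw^4 / delta up to constants,
    that is, order sqrt T / (log T)^2 with a single factor 1 / delta. *)

Section Frobenius.
Context {R : realType}.

Definition dotm {m n : nat} (X Y : 'M[R]_(m, n)) : R :=
  \sum_(i < m) \sum_(j < n) X i j * Y i j.

Lemma dotmC m n (X Y : 'M[R]_(m, n)) : dotm X Y = dotm Y X.
Proof. by apply: eq_bigr => i _; apply: eq_bigr => j _; rewrite mulrC. Qed.

Lemma dotmDr m n (X Y Z : 'M[R]_(m, n)) : dotm X (Y + Z) = dotm X Y + dotm X Z.
Proof.
rewrite /dotm -big_split; apply: eq_bigr => i _.
by rewrite -big_split; apply: eq_bigr => j _; rewrite mxE mulrDr.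
Qed.

Lemma dotmZr m n (X Y : 'M[R]_(m, n)) k : dotm X (k *: Y) = k * dotm X Y.
Proof.
rewrite /dotm mulr_sumr; apply: eq_bigr => i _.
by rewrite mulr_sumr; apply: eq_bigr => j _; rewrite mxE mulrCA.
Qed.

Lemma dotmDl m n (X Y Z : 'M[R]_(m, n)) : dotm (X + Y) Z = dotm X Z + dotm Y Z.
Proof. by rewrite dotmC dotmDr !(dotmC Z). Qed.

Lemma dotmZl m n (X Y : 'M[R]_(m, n)) k : dotm (k *: X) Y = k * dotm X Y.
Proof. by rewrite dotmC dotmZr (dotmC Y). Qed.

Lemma dotmNr m n (X Y : 'M[R]_(m, n)) : dotm X (- Y) = - dotm X Y.
Proof. by rewrite -scaleN1r dotmZr mulN1r. Qed.

Lemma dotmNl m n (X Y : 'M[R]_(m, n)) : dotm (- X) Y = - dotm X Y.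
Proof. by rewrite dotmC dotmNr dotmC. Qed.

Lemma dotm_ge0 m n (X : 'M[R]_(m, n)) : 0 <= dotm X X.
Proof. by apply: sumr_ge0 => i _; apply: sumr_ge0 => j _; rewrite -expr2 sqr_ge0. Qed.

Lemma frobnE m n (X : 'M[R]_(m, n)) : frobn X = Num.sqrt (dotm X X).
Proof.
by congr Num.sqrt; apply: eq_bigr => i _; apply: eq_bigr => j _; rewrite expr2.
Qed.

Lemma frobn_sqr m n (X : 'M[R]_(m, n)) : frobn X ^+ 2 = dotm X X.
Proof. by rewrite frobnE sqr_sqrtr// dotm_ge0. Qed.

Lemma frobn_ge0 m n (X : 'M[R]_(m, n)) : 0 <= frobn X.
Proof. by rewrite sqrtr_ge0. Qed.

Lemma frobnZ m n k (X : 'M[R]_(m, n)) : frobn (k *: X) = `|k| * frobn X.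
Proof.
rewrite !frobnE dotmZl dotmZr mulrA -expr2 sqrtrM ?sqr_ge0//.
by rewrite sqrtr_sqr.
Qed.

Lemma frobn0 m n : frobn (0 : 'M[R]_(m, n)) = 0.
Proof. by rewrite -(scale0r 0) frobnZ normr0 mul0r. Qed.

Lemma frobnN m n (X : 'M[R]_(m, n)) : frobn (- X) = frobn X.
Proof. by rewrite -scaleN1r frobnZ normrN1 mul1r. Qed.

Lemma frobnBC m n (X Y : 'M[R]_(m, n)) : frobn (X - Y) = frobn (Y - X).
Proof. by rewrite -frobnN opprB. Qed.

Lemma frobn_sqrD m n (X Y : 'M[R]_(m, n)) :
  frobn (X + Y) ^+ 2 = frobn X ^+ 2 + 2 * dotm X Y + frobn Y ^+ 2.
Proof. by rewrite !frobn_sqr dotmDl !dotmDr (dotmC Y X); ring. Qed.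

Lemma frobn_eq0 m n (X : 'M[R]_(m, n)) : frobn X = 0 -> X = 0.
Proof.
move=> X0; have := frobn_sqr X; rewrite X0 expr0n /= => /esym/eqP.
rewrite psumr_eq0; last first.
  by move=> i _; apply: sumr_ge0 => j _; rewrite -expr2 sqr_ge0.
move/allP => Xi; apply/matrixP => i j; rewrite mxE.
have /eqP := Xi i (mem_index_enum i) => /eqP; rewrite psumr_eq0; last first.
  by move=> j' _; rewrite -expr2 sqr_ge0.
move/allP => /(_ j (mem_index_enum j)) /=.
by rewrite -expr2 sqrf_eq0 => /eqP.
Qed.

(** Cauchy-Schwarz, by expanding the square of |Y| X - |X| Y once the zero cases are set aside. *)
Lemma dotm_le m n (X Y : 'M[R]_(m, n)) : dotm X Y <= frobn X * frobn Y.
Proof.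
have [/frobn_eq0->|X0] := eqVneq (frobn X) 0.
  by rewrite frobn0 mul0r -(scale0r 0) dotmZl mul0r.
have [/frobn_eq0->|Y0] := eqVneq (frobn Y) 0.
  by rewrite frobn0 mulr0 -(scale0r 0) dotmZr mul0r.
have xp : 0 < frobn X by rewrite lt_def X0 frobn_ge0.
have yp : 0 < frobn Y by rewrite lt_def Y0 frobn_ge0.
have := dotm_ge0 (frobn Y *: X - frobn X *: Y).
rewrite dotmDl !dotmDr !dotmNl !dotmNr !dotmZl !dotmZr -!frobn_sqr (dotmC Y X).
have xyp := mulr_gt0 xp yp.
set p := dotm X Y; set a := frobn X in xyp *; set b := frobn Y in xyp *.
have -> : b * (b * a ^+ 2) - b * (a * p) + (- (a * (b * p)) - - (a * (a * b ^+ 2))) =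
   (a * b) * (2 * (a * b - p)) by ring.
by rewrite pmulr_rge0// pmulr_rge0// subr_ge0.
Qed.

Lemma frobnD m n (X Y : 'M[R]_(m, n)) : frobn (X + Y) <= frobn X + frobn Y.
Proof.
rewrite -(@ler_pXn2r _ 2)// ?nnegrE ?addr_ge0 ?frobn_ge0//.
by have := dotm_le X Y; rewrite frobn_sqrD sqrrD; lra.
Qed.

Lemma frobnB m n (X Y : 'M[R]_(m, n)) : frobn (X - Y) <= frobn X + frobn Y.
Proof. by rewrite -(frobnN Y) frobnD. Qed.

Lemma frobn_sum m n (I : Type) (r : seq I) (p : pred I) (F : I -> 'M[R]_(m, n)) :
  frobn (\sum_(i <- r | p i) F i) <= \sum_(i <- r | p i) frobn (F i).
Proof.
elim/big_ind2 : _ => [|x1 y1 x2 y2 h1 h2|//]; first by rewrite frobn0.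
by apply: (le_trans (frobnD _ _)); rewrite lerD.
Qed.

Lemma vnormE n (x : 'cV[R]_n) : vnorm x = frobn x.
Proof.
by congr Num.sqrt; apply: eq_bigr => i _; rewrite big_ord1.
Qed.

(** Cauchy-Schwarz by induction on the list: the new cross term is absorbed by 4 u v <= (u +
    v)^2. *)
Lemma ler_sum_sqr (I : Type) (r : seq I) (a b : I -> R) :
  (\sum_(i <- r) a i * b i) ^+ 2 <=
  (\sum_(i <- r) a i ^+ 2) * (\sum_(i <- r) b i ^+ 2).
Proof.
elim: r => [|x r ih]; first by rewrite !big_nil expr0n mul0r.
rewrite !big_cons; set S := \sum_(_ <- _) _ in ih *.
set P := \sum_(_ <- _) _ in ih *; set Q := \sum_(_ <- _) _ in ih *.
have P0 : 0 <= P by apply: sumr_ge0 => i _; rewrite sqr_ge0.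
have Q0 : 0 <= Q by apply: sumr_ge0 => i _; rewrite sqr_ge0.
suff : 2 * (a x * b x) * S <= a x ^+ 2 * Q + P * b x ^+ 2 by lra.
have [c0|c0] := leP (2 * (a x * b x) * S) 0.
  by apply: (le_trans c0); rewrite addr_ge0// mulr_ge0// sqr_ge0.
rewrite -(@ler_pXn2r _ 2) ?nnegrE ?(ltW c0)//; last first.
  by rewrite addr_ge0// mulr_ge0// sqr_ge0.
apply: (@le_trans _ _ (4 * (a x * b x) ^+ 2 * (P * Q))).
  have -> : (2 * (a x * b x) * S) ^+ 2 = 4 * (a x * b x) ^+ 2 * S ^+ 2 by ring.
  by rewrite ler_wpM2l// mulr_ge0// sqr_ge0.
rewrite -subr_ge0.
have -> : (a x ^+ 2 * Q + P * b x ^+ 2) ^+ 2 - 4 * (a x * b x) ^+ 2 * (P * Q) =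
  (a x ^+ 2 * Q - P * b x ^+ 2) ^+ 2 by ring.
exact: sqr_ge0.
Qed.

Lemma frobn_mulmx m n p (X : 'M[R]_(m, n)) (Y : 'M[R]_(n, p)) :
  frobn (X *m Y) <= frobn X * frobn Y.
Proof.
rewrite -(@ler_pXn2r _ 2)// ?nnegrE ?mulr_ge0 ?frobn_ge0//.
rewrite exprMn !frobn_sqr {2}/dotm mulr_suml ler_sum// => i _.
apply: (@le_trans _ _ (\sum_(j < p) (\sum_(k < n) X i k ^+ 2) * (\sum_(k < n) Y k j ^+ 2))).
  by apply: ler_sum => j _; rewrite mxE -expr2 ler_sum_sqr.
rewrite -mulr_sumr exchange_big /= ler_wpM2r ?dotm_ge0//.
Qed.

Lemma specnorm_has_sup m n (M : 'M[R]_(m, n)) :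
  has_sup [set vnorm (M *m x) | x in [set x : 'cV[R]_n | vnorm x <= 1]].
Proof.
split; first by exists (vnorm (M *m 0)), 0 => //=; rewrite vnormE frobn0 ler01.
exists (frobn M) => _ [x /= x1 <-]; rewrite vnormE.
by apply: (le_trans (frobn_mulmx _ _)); rewrite ler_piMr ?frobn_ge0// -vnormE.
Qed.

Lemma specnorm_le m n (M : 'M[R]_(m, n)) c :
  specnorm M <= c <-> forall x : 'cV[R]_n, frobn x <= 1 -> frobn (M *m x) <= c.
Proof.
have [ne ub] := specnorm_has_sup M; split=> [Mc x x1|Mc].
  apply: le_trans Mc; apply: ub_le_sup => //.
  by exists x; rewrite /= ?vnormE.
by apply: ge_sup => // _ [x /= x1 <-]; rewrite vnormE Mc// -vnormE.
Qed.

Lemma specnorm_ge0 m n (M : 'M[R]_(m, n)) : 0 <= specnorm M.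
Proof.
apply: (le_trans (frobn_ge0 (M *m 0 : 'cV_m))).
by move/(specnorm_le M (specnorm M)): (lexx (specnorm M)) => -> //; rewrite frobn0.
Qed.

Lemma frobn_mulmxv m n (M : 'M[R]_(m, n)) (x : 'cV[R]_n) :
  frobn (M *m x) <= specnorm M * frobn x.
Proof.
have [/frobn_eq0->|x0] := eqVneq (frobn x) 0.
  by rewrite mulmx0 !frobn0 mulr0.
have xp : 0 < frobn x by rewrite lt_def x0 frobn_ge0.
have /specnorm_le/(_ ((frobn x)^-1 *: x)) := lexx (specnorm M).
rewrite -scalemxAr !frobnZ gtr0_norm ?invr_gt0// mulVf//.
by move=> /(_ (lexx _)); rewrite mulrC ler_pdivrMr.
Qed.

Lemma frobn_mulmxv_le m n (M : 'M[R]_(m, n)) (x : 'cV[R]_n) c b :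
  specnorm M <= c -> frobn x <= b -> frobn (M *m x) <= c * b.
Proof.
move=> Mc xb; apply: (le_trans (frobn_mulmxv _ _)).
by rewrite ler_pM ?specnorm_ge0 ?frobn_ge0.
Qed.

Lemma specnorm_le_scale m n (M : 'M[R]_(m, n)) c : 0 <= c ->
  (forall x : 'cV[R]_n, frobn (M *m x) <= c * frobn x) -> specnorm M <= c.
Proof.
move=> c0 Mc; apply/specnorm_le => x x1; apply: (le_trans (Mc x)).
by rewrite ler_piMr.
Qed.

(** Each column is the image of a unit basis vector. This dimension factor is the source of the sqrt
    n in the diameter [Dconst]. *)
Lemma frobn_le_specnorm m n (M : 'M[R]_(m, n)) :
  frobn M ^+ 2 <= n%:R * specnorm M ^+ 2.
Proof.
have -> : frobn M ^+ 2 = \sum_(j < n) frobn (col j M) ^+ 2.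
  rewrite frobn_sqr /dotm exchange_big; apply: eq_bigr => j _.
  rewrite frobn_sqr; apply: eq_bigr => i _.
  by rewrite big_ord1 !mxE.
rewrite mulr_natl -[X in _ *+ X]card_ord -sumr_const; apply: ler_sum => j _.
rewrite lerXn2r ?nnegrE ?frobn_ge0 ?specnorm_ge0// colE.
rewrite -[leRHS]mulr1 frobn_mulmxv_le//.
rewrite frobnE -[leRHS]sqrtr1 ler_sqrt// /dotm (bigD1 j)//= big_ord1 big1 ?addr0.
  by rewrite !mxE !eqxx mulr1.
by move=> i ij; rewrite big_ord1 !mxE (negPf ij) mul0r.
Qed.

End Frobenius.

(** * Complex spectral norm and powers of strongly stable closed loops *)

Section ComplexSpectralNorm.
Context {R : realType}.

Let re {m n} (M : 'M[R[i]]_(m, n)) : 'M[R]_(m, n) := map_mx (@complex.Re R) M.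
Let im {m n} (M : 'M[R[i]]_(m, n)) : 'M[R]_(m, n) := map_mx (@complex.Im R) M.

Lemma complexReM (a b : R[i]) : complex.Re (a * b) =
  complex.Re a * complex.Re b - complex.Im a * complex.Im b.
Proof. by case: a b => [? ?] [? ?]. Qed.

Lemma complexImM (a b : R[i]) : complex.Im (a * b) =
  complex.Re a * complex.Im b + complex.Im a * complex.Re b.
Proof. by case: a b => [? ?] [? ?]. Qed.

Let reM m n p (M : 'M[R[i]]_(m, n)) (N : 'M[R[i]]_(n, p)) :
  re (M *m N) = re M *m re N - im M *m im N.
Proof.
apply/matrixP => i j; rewrite !mxE raddf_sum -sumrB; apply: eq_bigr => k _.
by rewrite /= !mxE; exact: complexReM.
Qed.

Let imM m n p (M : 'M[R[i]]_(m, n)) (N : 'M[R[i]]_(n, p)) :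
  im (M *m N) = re M *m im N + im M *m re N.
Proof.
apply/matrixP => i j; rewrite !mxE raddf_sum -big_split; apply: eq_bigr => k _.
by rewrite /= !mxE; exact: complexImM.
Qed.

(* Viewing C^m as R^(2m) turns complex matrices into real block matrices. *)
Let realify {m} (z : 'cV[R[i]]_m) : 'cV[R]_(m + m) := col_mx (re z) (im z).

Let cvnormE m (z : 'cV[R[i]]_m) : cvnorm z = frobn (realify z).
Proof.
congr Num.sqrt; rewrite big_split_ord /= -big_split; apply: eq_bigr => i _.
by rewrite !big_ord1 col_mxEu col_mxEd !mxE.
Qed.

Let realifyM m n (M : 'M[R[i]]_(m, n)) (z : 'cV[R[i]]_n) :
  realify (M *m z) = block_mx (re M) (- im M) (im M) (re M) *m realify z.
Proof. by rewrite /realify mul_block_col reM imM mulNmx (addrC (re M *m im z)). Qed.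

Let realifyZ m (k : R) (z : 'cV[R[i]]_m) : realify (toC k *: z) = k *: realify z.
Proof.
rewrite /realify scale_col_mx; congr col_mx; apply/matrixP => i j; rewrite !mxE.
  by rewrite complexReM /= mul0r subr0.
by rewrite complexImM /= mul0r addr0.
Qed.

Let specnormC_has_ubound m n (M : 'M[R[i]]_(m, n)) :
  has_ubound [set cvnorm (M *m z) | z in [set z : 'cV[R[i]]_n | cvnorm z <= 1]].
Proof.
exists (frobn (block_mx (re M) (- im M) (im M) (re M))) => _ [z /= z1 <-].
rewrite cvnormE realifyM; apply: (le_trans (frobn_mulmx _ _)).
by rewrite ler_piMr ?frobn_ge0// -cvnormE.
Qed.

Lemma specnormC_ge0 m n (M : 'M[R[i]]_(m, n)) : 0 <= specnormC M.
Proof.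
apply: (@le_trans _ _ (cvnorm (M *m 0))); first by rewrite sqrtr_ge0.
apply: ub_le_sup => //; exists 0 => //=.
by rewrite cvnormE -[0](scale0r 0) realifyZ scale0r frobn0 ler01.
Qed.

Lemma cvnorm_mulmx m n (M : 'M[R[i]]_(m, n)) (z : 'cV[R[i]]_n) :
  cvnorm (M *m z) <= specnormC M * cvnorm z.
Proof.
have [z0|z0] := eqVneq (cvnorm z) 0.
  rewrite z0 mulr0 cvnormE realifyM.
  by move: z0; rewrite cvnormE => /frobn_eq0 ->; rewrite mulmx0 frobn0.
have zp : 0 < cvnorm z by rewrite lt_def z0 sqrtr_ge0.
rewrite -ler_pdivrMr//; apply: ub_le_sup => //.
exists (toC (cvnorm z)^-1 *: z) => /=.
  by rewrite cvnormE realifyZ frobnZ gtr0_norm ?invr_gt0// -cvnormE mulVf.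
by rewrite -scalemxAr cvnormE realifyZ frobnZ gtr0_norm ?invr_gt0// -cvnormE mulrC.
Qed.

Lemma cvnorm_mulmx_le m n (M : 'M[R[i]]_(m, n)) z c b :
  specnormC M <= c -> cvnorm z <= b -> cvnorm (M *m z) <= c * b.
Proof.
move=> Mc zb; apply: (le_trans (cvnorm_mulmx _ _)).
by rewrite ler_pM ?specnormC_ge0 ?sqrtr_ge0.
Qed.

Lemma cvnorm_toC m (x : 'cV[R]_m) : cvnorm (map_mx toC x) = frobn x.
Proof.
congr Num.sqrt; apply: eq_bigr => i _; rewrite big_ord1 !mxE /=.
by rewrite expr0n addr0.
Qed.

(** The powers telescope to Q P^j Q^-1, and a real vector keeps its norm in C^n; [Q] and its inverse
    contribute one [kappa] each. *)
Lemma frobn_mxpow_strongly_stable nx nu (A : 'M[R]_nx) (B : 'M[R]_(nx, nu))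
    kappa gamma (K : 'M[R]_(nu, nx)) j (x : 'cV[R]_nx) :
  gamma <= 1 -> strongly_stable A B kappa gamma K ->
  frobn (mxpow (A - B *m K) j *m x) <= kappa ^+ 2 * (1 - gamma) ^+ j * frobn x.
Proof.
move=> g1 [P [Q [Qu AE Pg _ [Qk Qik]]]].
have g0 : 0 <= 1 - gamma by rewrite subr_ge0.
have powE : map_mx toC (mxpow (A - B *m K) j *m x) =
    Q *m (iter j (mulmx P) (invmx Q *m map_mx toC x)).
  elim: j => [|j ih]; first by rewrite /mxpow /= mul1mx mulmxA mulmxV// mul1mx.
  rewrite /mxpow iterS -mulmxA (map_mxM (real_complex R)).
  rewrite -[map_mx (real_complex R) (A - _)]/(map_mx toC _) AE.
  rewrite -[map_mx (real_complex R) (_ *m _)]/(map_mx toC _) ih.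
  by rewrite iterS !mulmxA mulmxKV.
rewrite -!cvnorm_toC powE expr2 -!mulrA.
apply: cvnorm_mulmx_le => //.
rewrite mulrCA; elim: j {powE} => [|j ih]; first by rewrite expr0 mul1r cvnorm_mulmx_le.
by rewrite exprS -mulrA iterS cvnorm_mulmx_le.
Qed.

End ComplexSpectralNorm.

(** * Gradients of convex costs *)

Section Differentials.
Context {R : realType}.

Lemma mx_sum_delta_scale m n (X : 'M[R]_(m, n)) (V : lmodType R)
    (f : {linear 'M[R]_(m, n) -> V}) :
  f X = \sum_(i < m) \sum_(j < n) X i j *: f (delta_mx i j).
Proof.
rewrite {1}[X]matrix_sum_delta linear_sum; apply: eq_bigr => i _.
by rewrite linear_sum; apply: eq_bigr => j _; rewrite linearZ.
Qed.

Lemma mx_linear_differentiable m n (V : normedModType R)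
    (f : {linear 'M[R]_(m, n) -> V}) X : differentiable f X.
Proof.
have -> : (f : _ -> _) = \sum_(i < m) \sum_(j < n)
    (fun X : 'M[R]_(m, n) => X i j *: f (delta_mx i j)).
  apply/funext => Y; rewrite mx_sum_delta_scale fct_sumE; apply: eq_bigr => i _.
  by rewrite fct_sumE.
apply: differentiable_sum => i; apply: differentiable_sum => j.
by apply: differentiableZl; exact: differentiable_coord.
Qed.

Lemma frobn_continuous m n : continuous (@frobn R m n).
Proof.
have -> : @frobn R m n = Num.sqrt \o (\sum_(i < m) \sum_(j < n)
    ((fun X : 'M[R]_(m, n) => X i j) * (fun X : 'M[R]_(m, n) => X i j))).
  apply/funext => X; rewrite /= frobnE /dotm fct_sumE; congr Num.sqrt.
  by apply: eq_bigr => i _; rewrite fct_sumE.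
move=> X; apply: continuous_comp; last exact: sqrt_continuous.
apply: differentiable_continuous.
apply: differentiable_sum => i; apply: differentiable_sum => j.
by apply: differentiableM; exact: differentiable_coord.
Qed.

Lemma diff_grad m n (g : 'M[R]_(m, n) -> R) X N :
  differentiable g X -> 'd g X N = dotm (grad g X) N.
Proof.
move=> dg; rewrite mx_sum_delta_scale; apply: eq_bigr => i _; apply: eq_bigr => j _.
by rewrite mxE mulrC.
Qed.

(** Split (h, k) = (h, 0) + (0, k) and apply the chain rule to the two affine slices through (x,
    u). *)
Lemma diff_prod (V W : normedModType R) (g : V * W -> R) x u h k :
  differentiable g (x, u) ->
  'd g (x, u) (h, k) = 'd (fun x' => g (x', u)) x h + 'd (fun u' => g (x, u')) u k.
Proof.
move=> dg.
have dx : is_diff x (fun x' : V => (x', u)) (fun h => (h, 0)).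
  exact: is_diff_pair.
have du : is_diff u (fun u' : W => (x, u')) (fun h => (0, h)).
  exact: is_diff_pair.
rewrite (@diff_comp _ _ _ _ (fun x' => (x', u)) g x)//.
rewrite (@diff_comp _ _ _ _ (fun u' => (x, u')) g u)//.
by rewrite /= !diff_val -linearD /=; congr ('d _ _ _); congr pair; rewrite ?addr0 ?add0r.
Qed.

(** For 0 < h <= 1 convexity bounds the difference quotient along the segment by f z - f z'; the
    bound passes to the limit from the right. *)
Lemma convex_diff_le (V : normedModType R) (f : V -> R) (z z' : V) :
  (forall l, 0 <= l <= 1 -> f (l *: z + (1 - l) *: z') <= l * f z + (1 - l) * f z') ->
  differentiable f z' -> 'd f z' (z - z') <= f z - f z'.
Proof.
move=> cf df; rewrite -deriveE//.
have /cvg_dnbhs_at_right dz := diff_derivable (v := z - z') df.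
apply: (cvgr_to_le dz); near=> h.
have h0 : 0 < h by [].
have h1 : h <= 1 by near: h; exact: nbhs_right_le.
rewrite /GRing.scale /= ler_pdivrMl// mulrBr lerBlDr.
have -> : h *: (z - z') + z' = h *: z + (1 - h) *: z'.
  by rewrite scalerBr scalerBl scale1r -addrA; congr +%R; rewrite addrC.
apply: (le_trans (cf h _)); first by rewrite (ltW h0).
by rewrite mulrBl mul1r addrA addrAC.
Unshelve. all: by end_near. Qed.

Lemma mx_linear_diff m n (V : normedModType R)
    (f : {linear 'M[R]_(m, n) -> V}) X : 'd f X = f :> (_ -> _).
Proof.
apply: diff_lin => Y; apply: differentiable_continuous.
exact: mx_linear_differentiable.
Qed.

Lemma mx_affine_is_diff m n (V : normedModType R) (a : V)
    (f : {linear 'M[R]_(m, n) -> V}) X : is_diff X (fun Y => a + f Y) f.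
Proof.
have df : is_diff X f f.
  by apply: DiffDef; [exact: mx_linear_differentiable|exact: mx_linear_diff].
by apply: is_diff_eq (is_diffD (is_diff_cst a X) df) _; exact: add0r.
Qed.

Section Cost.
Context {nx nu : nat} (c : nat -> 'cV[R]_nx -> 'cV[R]_nu -> R) (Gc : R).
Hypothesis cA1 : assumption_A1 c Gc.

Let diff_cost t x u h k :
  'd (fun p : 'cV[R]_nx * 'cV[R]_nu => c t p.1 p.2) (x, u) (h, k) =
  dotm (gradx c t x u) h + dotm (gradu c t x u) k.
Proof.
have [_ _ dc _] := cA1; rewrite diff_prod//=.
rewrite !diff_grad//.
- exact: (@differentiable_comp _ _ _ _ (fun u' => (x, u'))
    (fun p : 'cV[R]_nx * 'cV[R]_nu => c t p.1 p.2)).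
- exact: (@differentiable_comp _ _ _ _ (fun x' => (x', u))
    (fun p : 'cV[R]_nx * 'cV[R]_nu => c t p.1 p.2)).
Qed.

Let cost_convex t x u x' u' :
  dotm (gradx c t x' u') (x - x') + dotm (gradu c t x' u') (u - u') <=
  c t x u - c t x' u'.
Proof.
have [_ cc dc _] := cA1; rewrite -diff_cost.
exact: (@convex_diff_le _ (fun p : 'cV[R]_nx * 'cV[R]_nu => c t p.1 p.2)
  (x, u) (x', u') (cc t x u x' u')).
Qed.

Let gradx_le t x u h : dotm (gradx c t x u) h <= Gc * frobn x * frobn h.
Proof.
have [_ _ _ /(_ t x u)[g _]] := cA1; apply: (le_trans (dotm_le _ _)).
by move: g; rewrite !vnormE => g; rewrite ler_wpM2r// frobn_ge0.
Qed.

Let gradu_le t x u h : dotm (gradu c t x u) h <= Gc * frobn u * frobn h.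
Proof.
have [_ _ _ /(_ t x u)[_ g]] := cA1; apply: (le_trans (dotm_le _ _)).
by move: g; rewrite !vnormE => g; rewrite ler_wpM2r// frobn_ge0.
Qed.

(** The first-order inequality is taken at (x, u), so only the norms of [x] and [u] appear; nothing
    has to be known about the size of x' and u'. *)
Lemma cost_diff_le t x u x' u' :
  c t x u - c t x' u' <= Gc * (frobn x * frobn (x - x') + frobn u * frobn (u - u')).
Proof.
have := cost_convex t x' u' x u; rewrite -(opprB x x') -(opprB u u') !dotmNr.
have := gradx_le t x u (x - x'); have := gradu_le t x u (u - u').
lra.
Qed.

Context {m n : nat} (y0 : 'cV[R]_nx) (v0 : 'cV[R]_nu).
Context (Ly : {linear 'M[R]_(m, n) -> 'cV[R]_nx}).
Context (Lv : {linear 'M[R]_(m, n) -> 'cV[R]_nu}).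

Let f t M := c t (y0 + Ly M) (v0 + Lv M).

Let diff_comp_affine t M : differentiable (f t) M /\ forall N, 'd (f t) M N =
  dotm (gradx c t (y0 + Ly M) (v0 + Lv M)) (Ly N) +
  dotm (gradu c t (y0 + Ly M) (v0 + Lv M)) (Lv N).
Proof.
have [_ _ dc _] := cA1.
have dy : is_diff M (fun M => y0 + Ly M) Ly by exact: mx_affine_is_diff.
have dv : is_diff M (fun M => v0 + Lv M) Lv by exact: mx_affine_is_diff.
have dp := is_diff_pair dy dv.
split=> [|N].
  exact: (@differentiable_comp _ _ _ _ (fun M => (y0 + Ly M, v0 + Lv M))
    (fun p : 'cV[R]_nx * 'cV[R]_nu => c t p.1 p.2)).
rewrite -diff_cost.
rewrite (@diff_comp _ _ _ _ (fun M => (y0 + Ly M, v0 + Lv M))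
    (fun p : 'cV[R]_nx * 'cV[R]_nu => c t p.1 p.2))//=.
by rewrite diff_val.
Qed.

(** The gradient g is tested against itself: |g|^2 is the differential at g, hence at most b |g|. *)
Lemma frobn_grad_comp_affine t M b : 0 <= b ->
  (forall N, Gc * (frobn (y0 + Ly M) * frobn (Ly N) + frobn (v0 + Lv M) * frobn (Lv N))
     <= b * frobn N) ->
  frobn (grad (f t) M) <= b.
Proof.
move=> b0 fb; have [df fE] := diff_comp_affine t M.
have [->//|g0] := eqVneq (frobn (grad (f t) M)) 0.
have gp : 0 < frobn (grad (f t) M) by rewrite lt_def g0 frobn_ge0.
rewrite -(ler_pM2r gp) -expr2 frobn_sqr -diff_grad// fE.
apply: le_trans (fb (grad (f t) M)); rewrite mulrDr !mulrA.
by rewrite lerD// ?gradx_le ?gradu_le.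
Qed.

Lemma grad_comp_affine_convex t M M' :
  f t M - f t M' <= dotm (grad (f t) M) (M - M').
Proof.
have [df fE] := diff_comp_affine t M.
rewrite -diff_grad// fE !linearB.
have := cost_convex t (y0 + Ly M') (v0 + Lv M') (y0 + Ly M) (v0 + Lv M).
have -> : y0 + Ly M' - (y0 + Ly M) = - (Ly M - Ly M') by rewrite opprB opprD addrACA subrr add0r.
have -> : v0 + Lv M' - (v0 + Lv M) = - (Lv M - Lv M') by rewrite opprB opprD addrACA subrr add0r.
by rewrite !dotmNr /f; lra.
Qed.

End Cost.

End Differentials.

(** * Projection onto the parameter set *)

Section Blocks.
Context {R : realType} {nx nu H : nat}.
Implicit Types M N : 'M[R]_(nu, H * nx).

Lemma blkE M (k : 'I_H) a b : blk M k a b = M a (mxvec_index k b).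
Proof. by rewrite mxE valK. Qed.

(* A named copy of blk, so that it can carry the canonical linear structure. *)
Definition blockof k M := blk M k.

Lemma blockof_is_linear k : linear (blockof k).
Proof.
move=> l M N; apply/matrixP => a b; rewrite !mxE.
by case: insubP => [i _ _|_]; rewrite ?mxE// mulr0 addr0.
Qed.

HB.instance Definition _ k := GRing.isLinear.Build R 'M[R]_(nu, H * nx)
  'M[R]_(nu, nx) _ (blockof k) (blockof_is_linear k).

Lemma blkZ l M k : blk (l *: M) k = l *: blk M k.
Proof. exact: (linearZ_LR (blockof k)). Qed.

Lemma blkD M N k : blk (M + N) k = blk M k + blk N k.
Proof. exact: (linearD (blockof k)). Qed.

Lemma frobn_sqr_blk M : frobn M ^+ 2 = \sum_(k < H) frobn (blk M k) ^+ 2.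
Proof.
under eq_bigr do rewrite frobn_sqr /dotm.
rewrite frobn_sqr /dotm [RHS]exchange_big /=; apply: eq_bigr => a _.
rewrite pair_bigA /= (reindex _ (curry_mxvec_bij _ _)) /=.
by apply: eq_bigr => -[k b] _ /=; rewrite !blkE.
Qed.

End Blocks.

Section Projection.
Context {R : realType} {nx nu H : nat} (B : 'M[R]_(nx, nu)) (kappa gamma : R).
Hypotheses (kappa0 : 0 <= kappa) (gamma1 : gamma <= 1).
Implicit Types M N X Y Z : 'M[R]_(nu, H * nx).

Let inM M := inM B kappa gamma M.

Lemma kappaB_ge1 : 1 <= kappaB B.
Proof. by rewrite /kappaB le_max lexx orbT. Qed.

Let rad (k : nat) := 2 * kappaB B * kappa ^+ 3 * (1 - gamma) ^+ k.

Let rad_ge0 k : 0 <= rad k.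
Proof.
have := kappaB_ge1 => kB; have g0 : 0 <= 1 - gamma by rewrite subr_ge0.
by rewrite /rad !mulr_ge0 ?exprn_ge0// (le_trans _ kB).
Qed.

Lemma inM0 : inM 0.
Proof.
move=> k; apply: specnorm_le_scale => [|x]; first exact: rad_ge0.
have -> : blk (0 : 'M[R]_(nu, H * nx)) k = 0 by rewrite -(scale0r 0) blkZ scale0r.
by rewrite mul0mx frobn0 mulr_ge0 ?rad_ge0 ?frobn_ge0.
Qed.

Lemma inM_convex l M N : 0 <= l <= 1 -> inM M -> inM N ->
  inM (l *: M + (1 - l) *: N).
Proof.
move=> /andP[l0 l1] MM NM k; have l1' : 0 <= 1 - l by rewrite subr_ge0.
apply/specnorm_le => x x1.
rewrite blkD !blkZ mulmxDl -!scalemxAl.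
apply: (le_trans (frobnD _ _)); rewrite !frobnZ !ger0_norm//.
rewrite -/(rad k).
have -> : rad k = l * rad k + (1 - l) * rad k by ring.
by rewrite lerD// ler_wpM2l//; [move/specnorm_le : (MM k)|move/specnorm_le : (NM k)];
  apply.
Qed.

Lemma inM_frobn M : inM M ->
  frobn M ^+ 2 <= \sum_(k < H) nx%:R * rad k ^+ 2.
Proof.
move=> MM; rewrite frobn_sqr_blk; apply: ler_sum => k _.
apply: (le_trans (frobn_le_specnorm _)).
by rewrite ler_wpM2l// lerXn2r ?nnegrE ?specnorm_ge0 ?rad_ge0//; exact: MM.
Qed.

(** [projM] is an [xget] with default 0, so it means something only once a minimizer exists. The
    parameter set is viewed as a set of row vectors, the form in which [bounded_closed_compact]
    yields compactness. *)
Let projM_exists X : exists Y, inM Y /\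
  forall Z, inM Z -> frobn (X - Y) <= frobn (X - Z).
Proof.
pose S := [set v : 'rV[R]_(nu * (H * nx)) | inM (vec_mx v)].
have lin_cont m n p q (f : {linear 'M[R]_(m, n) -> 'M[R]_(p, q)}) : continuous f.
  by move=> Y; apply: differentiable_continuous; exact: mx_linear_differentiable.
have S0 : S !=set0 by exists 0; rewrite /S /= linear0; exact: inM0.
have Sb : bounded_set S.
  exists (Num.sqrt (\sum_(k < H) nx%:R * rad k ^+ 2)); split; first exact: num_real.
  move=> r /ltW br v /inM_frobn vb; apply: le_trans br.
  have vE : frobn v = frobn (vec_mx v : 'M[R]_(nu, H * nx)).
    rewrite !frobnE /dotm big_ord1 pair_bigA /=; congr Num.sqrt.
    rewrite (reindex _ (curry_mxvec_bij _ _)) /=.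
    by apply: eq_bigr => -[k b] _ /=; rewrite !mxE.
  apply: (@le_trans _ _ (frobn v)).
    rewrite [leLHS]/Num.norm /= mx_normrE; apply/bigmax_leP; split; first exact: frobn_ge0.
    move=> -[i j] _ /=; rewrite -sqrtr_sqr frobnE ler_wsqrtr//.
    rewrite ord1 /dotm big_ord1 (bigD1 j)//= expr2 lerDl.
    by apply: sumr_ge0 => k _; rewrite -expr2 sqr_ge0.
  by rewrite vE -[leLHS]ger0_norm ?frobn_ge0// -sqrtr_sqr ler_wsqrtr.
have Sc : closed S.
  (* The spectral constraint is a family of closed conditions, one for each block and each vector of
     the unit ball, which avoids continuity of a supremum. *)
  have -> : S = \bigcap_(k in [set: 'I_H]) \bigcap_(x in [set x : 'cV[R]_nx | frobn x <= 1])
      ((fun v => frobn (blk (vec_mx v : 'M[R]_(nu, H * nx)) k *m x)) @^-1` [set r | r <= rad k]).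
    apply/seteqP; split=> [v vS k _ x x1 /=|v vS k].
      by move/specnorm_le : (vS k); apply.
    by apply/specnorm_le => x x1; exact: vS.
  apply: closed_bigI => k _; apply: closed_bigI => x _.
  apply: (continuous_closedP _).1; last exact: closed_le.
  move=> v; apply: (@continuous_comp _ _ _ (mulmxr x \o blockof k \o vec_mx) (@frobn R _ _) v).
    exact: (lin_cont _ _ _ _ (mulmxr x \o blockof k \o vec_mx)).
  exact: frobn_continuous.
have dist_cont : {within S, continuous (fun v => frobn (X - vec_mx v))}.
  apply: continuous_subspaceT => v.
  apply: (@continuous_comp _ _ _ (fun v => X - vec_mx v) (@frobn R _ _) v).
    by apply: continuousB; [exact: cst_continuous|exact: (lin_cont _ _ _ _ vec_mx)].
  exact: frobn_continuous.
have [v vS vmin] := compact_EVT_min S0 (bounded_closed_compact Sb Sc) dist_cont.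
exists (vec_mx v); split; first by rewrite inE in vS.
move=> Z ZM; rewrite -[Z]mxvecK; apply: vmin.
by rewrite inE /S /= mxvecK.
Qed.

Let projMP X : inM (projM B kappa gamma X) /\
  forall Z, inM Z -> frobn (X - projM B kappa gamma X) <= frobn (X - Z).
Proof. exact: (xgetPex 0 (projM_exists X)). Qed.

Lemma inM_projM X : inM (projM B kappa gamma X).
Proof. exact: (projMP X).1. Qed.

(** Minimality along the segment from the projection Y to Z gives 2 d <= l q for all 0 < l <= 1, so
    d <= 0: the angle at Y is not acute, and X is at least as far from Z as Y is. *)
Lemma projM_le X Z : inM Z -> frobn (projM B kappa gamma X - Z) <= frobn (X - Z).
Proof.
move=> ZM; have [YM Ymin] := projMP X; set Y := projM _ _ _ _ in YM Ymin *.
pose d := dotm (X - Y) (Z - Y); pose q := frobn (Z - Y) ^+ 2.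
have XlE l : frobn (X - Y - l *: (Z - Y)) ^+ 2 =
    frobn (X - Y) ^+ 2 - 2 * l * d + l ^+ 2 * q.
  rewrite frobn_sqrD dotmNr dotmZr frobnN frobnZ exprMn real_normK ?num_real//.
  by rewrite -/d -/q; ring.
have dq l : 0 < l <= 1 -> 2 * d <= l * q.
  move=> /andP[l0 l1]; have ln : 0 <= l <= 1 by rewrite ltW.
  have := Ymin _ (inM_convex ln ZM YM).
  have -> : X - (l *: Z + (1 - l) *: Y) = X - Y - l *: (Z - Y).
    by apply/matrixP => i j; rewrite !mxE; ring.
  rewrite -(@ler_pXn2r _ 2)// ?nnegrE ?frobn_ge0// XlE => h.
  rewrite -(ler_pM2l l0); lra.
have d0 : d <= 0.
  rewrite leNgt; apply/negP => d0.
  have q1 : 2 * d <= q by rewrite -[q]mul1r dq// ltr01 lexx.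
  have q0 : 0 < q by lra.
  (* The choice l = d / q would give 2 d <= d, contradicting d > 0. *)
  have /dq : 0 < d / q <= 1 by rewrite divr_gt0//= ler_pdivrMr//; lra.
  by rewrite divfK ?gt_eqF//; lra.
rewrite -(@ler_pXn2r _ 2)// ?nnegrE ?frobn_ge0//.
have -> : X - Z = X - Y - 1 *: (Z - Y) by rewrite scale1r opprB addrA subrK.
rewrite XlE frobnBC -/q; have := sqr_ge0 (frobn (X - Y)); lra.
Qed.

End Projection.

(** * Lagged and exponentially filtered sequences *)

Section LaggedSequences.
Context {V : zmodType}.

(* z (t - 1 - k), read as 0 at negative times. *)
Definition lag (z : nat -> V) (t k : nat) : V :=
  if (k < t)%N then z (t.-1 - k)%N else 0.

Lemma lag0 z k : lag z 0 k = 0. Proof. by []. Qed.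

Lemma lagS0 z t : lag z t.+1 0 = z t.
Proof. by rewrite /lag /= subn0. Qed.

Lemma lagSS z t k : lag z t.+1 k.+1 = lag z t k.
Proof. by rewrite /lag ltnS /= subnS -predn_sub. Qed.

Lemma lag_out z t k : (t <= k)%N -> lag z t k = 0.
Proof. by rewrite /lag ltnNge => ->. Qed.

End LaggedSequences.

Section Filter.
Context {R : realType}.
Implicit Types (z : nat -> R) (lam : R).

Lemma lag_ge0 z t k : (forall s, 0 <= z s) -> 0 <= lag z t k.
Proof. by move=> z0; rewrite /lag; case: ifP. Qed.

Lemma sum_lag_lag z t n : (forall s, 0 <= z s) ->
  \sum_(k < n) lag z t k <= \sum_(s < t) z s.
Proof.
move=> z0; elim: t n => [|t ih] [|n].
- by rewrite !big_ord0.
- by rewrite big_ord0 big1.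
- by rewrite big_ord0 sumr_ge0.
rewrite big_ord_recl lagS0 big_ord_recr /= [leRHS]addrC lerD2l.
by under eq_bigr do rewrite lagSS; exact: ih.
Qed.

Lemma sum_lag_time z T k : (forall s, 0 <= z s) ->
  \sum_(t < T) lag z t k <= \sum_(t < T) z t.
Proof.
move=> z0; elim: T k => [|T ih] [|k]; rewrite ?big_ord0//.
  rewrite big_ord_recl lag0 add0r big_ord_recr /=.
  by under eq_bigr do rewrite lagS0; rewrite lerDl.
rewrite big_ord_recl lag0 add0r big_ord_recr /=.
under eq_bigr do rewrite lagSS.
by rewrite (le_trans (ih k))// lerDl.
Qed.

(* filt lam z t is \sum_(j < t) lam ^+ j * z (t - 1 - j). *)
Fixpoint filt lam z t : R := if t is t'.+1 then lam * filt lam z t' + z t' else 0.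

Lemma filt_ge0 lam z t : 0 <= lam -> (forall s, 0 <= z s) -> 0 <= filt lam z t.
Proof. by move=> l0 z0; elim: t => //= t ih; rewrite addr_ge0 ?mulr_ge0. Qed.

Lemma ler_filt lam z z' t : 0 <= lam -> (forall s, (s < t)%N -> z s <= z' s) ->
  filt lam z t <= filt lam z' t.
Proof.
move=> l0; elim: t => //= t ih zz; rewrite lerD ?zz// ler_wpM2l// ih// => s st.
by rewrite zz// ltnS ltnW.
Qed.

Lemma filtD lam z z' t : filt lam (fun s => z s + z' s) t = filt lam z t + filt lam z' t.
Proof. by elim: t => [|t /= ->]; rewrite /= ?addr0//; ring. Qed.

Lemma filtZ lam k z t : filt lam (fun s => k * z s) t = k * filt lam z t.
Proof. by elim: t => [|t /= ->]; rewrite /= ?mulr0//; ring. Qed.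

Lemma sum_lag_filt lam z t n : 0 <= lam -> (forall s, 0 <= z s) ->
  \sum_(k < n) lam ^+ k * lag z t k <= filt lam z t.
Proof.
move=> l0 z0; elim: t n => [|t ih] [|n].
- by rewrite !big_ord0.
- by rewrite big1// => i _; rewrite lag0 mulr0.
- by rewrite big_ord0 filt_ge0.
rewrite big_ord_recl lagS0 mul1r /= [leRHS]addrC lerD2l.
under eq_bigr do rewrite lagSS exprS -mulrA.
by rewrite -mulr_sumr ler_wpM2l// ih.
Qed.

(** Mass balance obtained by summing the recursion over time; dropping the nonnegative final value
    yields the l^1 bound with gain 1 / (1 - lam). *)
Lemma sum_filt lam z T : filt lam z T + (1 - lam) * \sum_(t < T) filt lam z t =
  \sum_(t < T) z t.
Proof.
elim: T => [|T ih]; first by rewrite !big_ord0 mulr0 addr0.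
by rewrite !big_ord_recr /= -ih; ring.
Qed.

Lemma sum_filt_le lam z T : 0 <= lam -> lam < 1 -> (forall s, 0 <= z s) ->
  \sum_(t < T) filt lam z t <= (\sum_(t < T) z t) / (1 - lam).
Proof.
move=> l0 l1 z0; rewrite ler_pdivlMr ?subr_gt0// mulrC -(sum_filt lam z T).
by rewrite lerDr filt_ge0.
Qed.

(** Convexity of the square, used twice. *)
Lemma pow4_convex (l a b : R) : 0 <= l <= 1 ->
  (l * a + (1 - l) * b) ^+ 4 <= l * a ^+ 4 + (1 - l) * b ^+ 4.
Proof.
move=> /andP[l0 l1]; have l1' : 0 <= 1 - l by rewrite subr_ge0.
have sq x y : (l * x + (1 - l) * y) ^+ 2 <= l * x ^+ 2 + (1 - l) * y ^+ 2.
  rewrite -subr_ge0.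
  have -> : l * x ^+ 2 + (1 - l) * y ^+ 2 - (l * x + (1 - l) * y) ^+ 2 =
    l * (1 - l) * (x - y) ^+ 2 by ring.
  by rewrite mulr_ge0 ?sqr_ge0// mulr_ge0.
apply: (@le_trans _ _ ((l * a ^+ 2 + (1 - l) * b ^+ 2) ^+ 2)).
  rewrite -[4%N]/(2 * 2)%N exprM lerXn2r ?nnegrE ?sqr_ge0// ?sq//.
  by rewrite addr_ge0// mulr_ge0 ?sqr_ge0.
by apply: (le_trans (sq _ _)); rewrite -!exprM.
Qed.

(** Jensen step by step: the recursion is the convex combination of the previous value and z t / (1
    - lam), with weights lam and 1 - lam. One of the four factors 1 / (1 - lam) cancels against the
    weight. *)
Lemma filt_pow4 lam z t : 0 <= lam -> lam < 1 ->
  filt lam z t ^+ 4 <= filt lam (fun s => z s ^+ 4) t / (1 - lam) ^+ 3.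
Proof.
move=> l0 l1; have g0 : 0 < 1 - lam by rewrite subr_gt0.
elim: t => [|t ih]; first by rewrite expr0n mul0r.
rewrite /= mulrDl -mulrA.
apply: (@le_trans _ _ (lam * filt lam z t ^+ 4 + (1 - lam) * (z t / (1 - lam)) ^+ 4)).
  set b := z t / (1 - lam).
  have -> : z t = (1 - lam) * b by rewrite mulrC divfK ?gt_eqF.
  by rewrite pow4_convex// l0 ltW.
rewrite lerD ?ler_wpM2l// expr_div_n.
by rewrite mulrC -mulrA ler_wpM2l ?exprn_even_ge0// exprS invfM mulrAC mulVf ?gt_eqF// mul1r.
Qed.

Lemma sum_filt_pow4 lam z T : 0 <= lam -> lam < 1 ->
  \sum_(t < T) filt lam z t ^+ 4 <= (\sum_(t < T) z t ^+ 4) / (1 - lam) ^+ 4.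
Proof.
move=> l0 l1; have g0 : 0 < 1 - lam by rewrite subr_gt0.
apply: (@le_trans _ _ (\sum_(t < T) filt lam (fun s => z s ^+ 4) t / (1 - lam) ^+ 3)).
  by apply: ler_sum => t _; exact: filt_pow4.
have -> : (1 - lam) ^+ 4 = (1 - lam) * (1 - lam) ^+ 3 by rewrite exprS.
rewrite -[leLHS]mulr_suml [in leRHS]invfM mulrA ler_wpM2r ?invr_ge0 ?exprn_ge0 ?(ltW g0)//.
by apply: sum_filt_le => // s; rewrite exprn_even_ge0.
Qed.

Lemma filt_cst_le lam (c : R) t : 0 <= lam -> lam < 1 -> 0 <= c ->
  filt lam (fun=> c) t <= c / (1 - lam).
Proof.
move=> l0 l1 c0; have g0 : 0 < 1 - lam by rewrite subr_gt0.
elim: t => [|t /(ler_wpM2l l0)] /=; first by rewrite divr_ge0// ltW.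
have -> : lam * (c / (1 - lam)) = c / (1 - lam) - c by field; rewrite gt_eqF.
lra.
Qed.

(** A factor [p] frozen at the current time is moved inside the filter. Young's inequality at each
    past time may then cost a constant [b], whose total filtered weight is at most b / (1 - lam),
    plus a sequence [q] that is filtered again. *)
Lemma mul_filt_le lam z p (b : R) (q : nat -> R) t : 0 <= lam -> lam < 1 ->
  0 <= b -> (forall s, (s < t)%N -> p * z s <= b + q s) ->
  p * filt lam z t <= b / (1 - lam) + filt lam q t.
Proof.
move=> l0 l1 b0; have g0 : 0 < 1 - lam by rewrite subr_gt0.
elim: t => [|t ih] pz /=; first by rewrite mulr0 addr0 divr_ge0// ltW.
have {}ih := ih (fun s st => pz s (ltnW st)); have := pz t (ltnSn t).
have /(ler_wpM2l l0) := ih.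
have -> : lam * (b / (1 - lam) + filt lam q t) =
  b / (1 - lam) - b + lam * filt lam q t by field; rewrite gt_eqF.
lra.
Qed.

End Filter.

(** * Closed form of the dynamics *)

Section Convolution.
Context {R : realType}.

(** True states and surrogate states are both of this form and differ in the length [n]: any n >= t
    gives the whole past, H.+1 the surrogate. *)
Definition conv {p q : nat} (F : nat -> 'M[R]_(p, q)) (n : nat)
    (g : nat -> 'cV[R]_q) (t : nat) : 'cV[R]_p :=
  \sum_(j < n) F j *m lag g t j.

Lemma frobn_lag q (g : nat -> 'cV[R]_q) t k :
  frobn (lag g t k) = lag (fun s => frobn (g s)) t k.
Proof. by rewrite /lag; case: ifP => // _; rewrite frobn0. Qed.

Lemma lag_le (z z' : nat -> R) t k : (forall s, (s < t)%N -> z s <= z' s) ->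
  lag z t k <= lag z' t k.
Proof.
rewrite /lag => zz; case: ifP => // kt; apply: zz.
by case: t kt => // t _; rewrite ltnS leq_subr.
Qed.

Section Bounds.
Context {p q : nat} (F : nat -> 'M[R]_(p, q)) (a lam : R) (g : nat -> 'cV[R]_q).
Context (G : nat -> R) (t : nat).
Hypotheses (a0 : 0 <= a) (l0 : 0 <= lam) (l1 : lam < 1) (G0 : forall s, 0 <= G s).
Hypothesis gG : forall s, (s < t)%N -> frobn (g s) <= G s.

Let term_le m j : (forall j, (j < m)%N -> specnorm (F j) <= a * lam ^+ j) ->
  (j < m)%N -> frobn (F j *m lag g t j) <= a * (lam ^+ j * lag G t j).
Proof.
move=> Fa jm; rewrite mulrA frobn_mulmxv_le ?Fa//.
by rewrite frobn_lag lag_le.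
Qed.

Lemma frobn_conv_le n : (forall j, (j < n)%N -> specnorm (F j) <= a * lam ^+ j) ->
  frobn (conv F n g t) <= a * filt lam G t.
Proof.
move=> Fa; apply: (le_trans (frobn_sum _ _ _)).
apply: (@le_trans _ _ (\sum_(j < n) a * (lam ^+ j * lag G t j))).
  by apply: ler_sum => j _; exact: (term_le Fa).
by rewrite -mulr_sumr ler_wpM2l// sum_lag_filt.
Qed.

Lemma frobn_conv_tail n m : (n <= m)%N ->
  (forall j, (j < m)%N -> specnorm (F j) <= a * lam ^+ j) ->
  frobn (conv F m g t - conv F n g t) <= a * lam ^+ n * \sum_(s < t) G s.
Proof.
move=> nm Fa; rewrite /conv -!(big_mkord xpredT (fun j => F j *m lag g t j)).
rewrite (big_cat_nat (n := n))//= addrAC subrr add0r.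
apply: (le_trans (frobn_sum _ _ _)).
apply: (@le_trans _ _ (\sum_(n <= j < m) a * lam ^+ n * lag G t j)).
  rewrite big_nat [leRHS]big_nat; apply: ler_sum => j /andP[nj jm].
  apply: (le_trans (term_le Fa jm)); rewrite -mulrA ler_wpM2l// ler_wpM2r ?lag_ge0//.
  by rewrite ler_wiXn2l// ltW.
rewrite -mulr_sumr ler_wpM2l ?mulr_ge0 ?exprn_ge0//.
apply: le_trans (sum_lag_lag t m G0).
rewrite -(big_mkord xpredT (lag G t)) [leRHS](big_cat_nat (n := n))//= lerDr.
by apply: sumr_ge0 => j _; exact: lag_ge0.
Qed.

End Bounds.

Lemma conv_widen p q (F : nat -> 'M[R]_(p, q)) n g t : (t <= n)%N ->
  conv F n g t = conv F t g t.
Proof.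
move=> tn; rewrite /conv -!(big_mkord xpredT (fun j => F j *m lag g t j)).
rewrite (big_cat_nat (n := t))//= [X in _ + X](_ : _ = 0) ?addr0//.
by rewrite big_nat big1// => j /andP[tj _]; rewrite lag_out// mulmx0.
Qed.

(** Variation of constants. The length is left free above [t] so that a state and its surrogate can
    be written at the common length [maxn H.+1 t], one being a truncation of the other. *)
Lemma conv_recurrence p (M : 'M[R]_p) (x g : nat -> 'cV[R]_p) n t :
  x 0%N = 0 -> (forall s, x s.+1 = M *m x s + g s) -> (t <= n)%N ->
  x t = conv (mxpow M) n g t.
Proof.
move=> x0 xS tn; rewrite conv_widen//; elim: t {tn} => [|t ih].
  by rewrite /conv big_ord0.
rewrite /conv big_ord_recl lagS0 mul1mx addrC xS ih; congr +%R.
rewrite /conv mulmx_sumr; apply: eq_bigr => j _.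
by rewrite lagSS mulmxA.
Qed.

Lemma convD p q (F : nat -> 'M[R]_(p, q)) n g g' t :
  conv F n (fun s => g s + g' s) t = conv F n g t + conv F n g' t.
Proof.
rewrite /conv -big_split; apply: eq_bigr => j _ /=.
by rewrite /lag; case: ifP; rewrite ?mulmxDr// !mulmx0 addr0.
Qed.

Lemma convZ p q (F : nat -> 'M[R]_(p, q)) n k g t :
  conv F n (fun s => k *: g s) t = k *: conv F n g t.
Proof.
rewrite /conv scaler_sumr; apply: eq_bigr => j _ /=.
by rewrite /lag; case: ifP; rewrite -?scalemxAr// !mulmx0 scaler0.
Qed.

Lemma convB p q (F : nat -> 'M[R]_(p, q)) n g g' t :
  conv F n g t - conv F n g' t = conv F n (fun s => g s - g' s) t.
Proof.
rewrite -scaleN1r -convZ -convD; congr conv; apply/funext => s.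
by rewrite scaleN1r.
Qed.

Lemma eq_conv p q (F F' : nat -> 'M[R]_(p, q)) n g g' t :
  (forall j, (j < n)%N -> F j = F' j) -> (forall s, (s < t)%N -> g s = g' s) ->
  conv F n g t = conv F' n g' t.
Proof.
move=> FF gg; apply: eq_bigr => j _; rewrite FF//; congr mulmx.
rewrite /lag; case: ifP => // jt; apply: gg.
by case: t jt => // t _; rewrite ltnS leq_subr.
Qed.

End Convolution.

Section ClosedForm.
Context {R : realType} {nx nu H : nat} (A : 'M[R]_nx) (B : 'M[R]_(nx, nu)).
Context (K : 'M[R]_(nu, nx)) (w : nat -> 'cV[R]_nx).
Implicit Types M : 'M[R]_(nu, H * nx).

Definition disturbance_input M t := conv (blk M) H w t.

Lemma wz_lag t k : wz w (t%:Z - k.+1%:Z) = lag w t k.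
Proof.
rewrite /lag; case: ltnP => kt; last first.
  have [] : exists n, t%:Z - k.+1%:Z = Negz n.
    by exists (k - t)%N; rewrite NegzE; lia.
  by move=> n ->.
by have -> : t%:Z - k.+1%:Z = (t.-1 - k)%N by lia.
Qed.

Lemma dap_inputE t x M :
  dap_input K w t x M = - (K *m x) + disturbance_input M t.
Proof. by congr +%R; apply: eq_bigr => k _; rewrite wz_lag. Qed.

(** For fixed j the indicator in [Psi] selects i = j + 1 + k with k < H. For j <= H all these
    indices lie below N = 2H + 1. *)
Lemma sum_window (V : nmodType) N j (F : nat -> V) : (j + H < N)%N ->
  \sum_(i < N) (if (j < i)%N && (i - j <= H)%N then F i else 0) =
  \sum_(k < H) F (j.+1 + k)%N.
Proof.
move=> jN; rewrite -(big_mkord xpredT (fun i =>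
  if (j < i)%N && (i - j <= H)%N then F i else 0)).
rewrite (big_cat_nat (n := j.+1))//=; last by lia.
rewrite [X in X + _](_ : _ = 0) ?add0r; last first.
  by rewrite big_nat big1// => i ij; case: ifP => //; lia.
rewrite (big_cat_nat (n := j.+1 + H))//=; last exact: leq_addr.
rewrite [X in _ + X](_ : _ = 0) ?addr0; last first.
  by rewrite big_nat big1// => i ij; case: ifP => //; lia.
rewrite -{1}[j.+1]add0n big_addn addKn big_mkord; apply: eq_bigr => k _.
rewrite (addnC k); case: ifP => //; have := ltn_ord k; lia.
Qed.

(** Reindexing the double sum by k = i - j - 1 makes the inner sum the disturbance input at time t -
    1 - j. The surrogate is thus the closed loop restarted from 0 at H + 1 steps before [t]; the
    pairs j <= H, k < H reach exactly i <= 2H. *)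
Lemma ysurE (Ms : int -> 'M[R]_(nu, H * nx)) (t : nat) :
  ysur A B K w Ms t = conv (mxpow (A - B *m K)) H.+1
    (fun s => B *m disturbance_input (Ms s) s + w s) t.
Proof.
rewrite convD addrC /ysur.
under eq_bigr => i _.
  have -> : t%:Z - 1 - i%:Z = t%:Z - i.+1%:Z by lia.
  rewrite wz_lag /Psi mulmxDl mulmx_suml; over.
rewrite big_split /=; congr +%R.
  rewrite /conv (big_ord_widen (2 * H).+1 (fun i => mxpow (A - B *m K) i *m lag w t i))//.
    rewrite [RHS]big_mkcond; apply: eq_bigr => i _.
    by rewrite ltnS; case: ifP; rewrite ?mul0mx.
  by lia.
rewrite exchange_big; apply: eq_bigr => j _ /=.
have jH := ltn_ord j.
transitivity (\sum_(i < (2 * H).+1) (if (j < i)%N && (i - j <= H)%N then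
    mxpow (A - B *m K) j *m B *m blk (Ms (t%:Z - 1 - j%:Z)) (i - j - 1) *m lag w t i
    else 0)).
  by apply: eq_bigr => i _; case: ifP => // _; rewrite mul0mx.
rewrite (sum_window (fun i => mxpow (A - B *m K) j *m B *m
  blk (Ms (t%:Z - 1 - j%:Z)) (i - j - 1) *m lag w t i)); last by lia.
rewrite /lag; case: ltnP => jt; last first.
  by rewrite mulmx0 big1// => k _; case: ifP => [|_]; [lia|rewrite mulmx0].
have -> : t%:Z - 1 - j%:Z = (t.-1 - j)%N by lia.
rewrite mulmxA mulmx_sumr; apply: eq_bigr => k _.
rewrite -!mulmxA; do 2 congr mulmx.
have -> : (j.+1 + k - j - 1)%N = k by lia.
congr mulmx; rewrite /lag.
have -> : (k < t.-1 - j)%N = (j.+1 + k < t)%N by lia.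
by case: ifP => // _; congr w; lia.
Qed.

Lemma vsurE (Ms : int -> 'M[R]_(nu, H * nx)) (t : nat) :
  vsur A B K w Ms t = - (K *m ysur A B K w Ms t) + disturbance_input (Ms t) t.
Proof. by congr +%R; apply: eq_bigr => k _; rewrite wz_lag. Qed.

End ClosedForm.

(** * Pathwise regret bound *)

Section Deterministic.
Context {R : realType} {nx nu : nat} (A : 'M[R]_nx) (B : 'M[R]_(nx, nu)).
Context (kappa gamma : R) (K : 'M[R]_(nu, nx)).
Context (c : nat -> 'cV[R]_nx -> 'cV[R]_nu -> R) (Gc : R) (w : nat -> 'cV[R]_nx) (H : nat).
Hypotheses (kappa1 : 1 <= kappa) (gamma01 : 0 < gamma < 1).
Hypotheses (cA1 : assumption_A1 c Gc) (Kst : strongly_stable A B kappa gamma K).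
Implicit Types M N : 'M[R]_(nu, H * nx).

Let lam := 1 - gamma.
Let kB := kappaB B.
Let AK := A - B *m K.
Let W s := frobn (w s).
(** The disturbance input of an admissible parameter is of order [xi]; the closed loop filters it
    once more, whence [xi2]. *)
Let xi := filt lam W.
Let xi2 := filt lam xi.

Let gamma0 : 0 < gamma. Proof. by case/andP: gamma01. Qed.
Let lam0 : 0 <= lam. Proof. by rewrite subr_ge0 ltW//; case/andP: gamma01. Qed.
Let lam1 : lam < 1. Proof. by rewrite /lam; have := gamma0; lra. Qed.
Let lamE : 1 - lam = gamma. Proof. by rewrite /lam; ring. Qed.
Let kappa0 : 0 <= kappa. Proof. exact: le_trans ler01 kappa1. Qed.
Let kB1 : 1 <= kB. Proof. exact: kappaB_ge1. Qed.
Let kB0 : 0 <= kB. Proof. exact: le_trans ler01 kB1. Qed.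
Let Gc0 : 0 <= Gc. Proof. by have [G1 _ _ _] := cA1; exact: le_trans ler01 G1. Qed.
Let W0 s : 0 <= W s. Proof. exact: frobn_ge0. Qed.
Let xi0 s : 0 <= xi s. Proof. exact: filt_ge0. Qed.
Let xi20 s : 0 <= xi2 s. Proof. exact: filt_ge0. Qed.

Let specnormB : specnorm B <= kB. Proof. by rewrite /kB /kappaB le_max lexx. Qed.
Let specnormK : specnorm K <= kappa. Proof. by case: Kst => P [Q []]. Qed.

Let specnorm_pow (K' : 'M[R]_(nu, nx)) j : strongly_stable A B kappa gamma K' ->
  specnorm (mxpow (A - B *m K') j) <= kappa ^+ 2 * lam ^+ j.
Proof.
move=> K'st; apply: specnorm_le_scale => [|x].
  by rewrite mulr_ge0 ?exprn_ge0.
by apply: frobn_mxpow_strongly_stable K'st; case/andP: gamma01 => _ /ltW.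
Qed.

(* G majorizes the forcing B u + w of the closed loop x' = (A - B K) x + B u + w,
   and Y all the states and inputs, true or surrogate. *)
Let G s := 2 * kB ^+ 2 * kappa ^+ 3 * xi s + W s.
Let G0 s : 0 <= G s.
Proof. by rewrite /G addr_ge0// !mulr_ge0 ?exprn_ge0. Qed.

Let Y t := kB ^+ 2 * kappa ^+ 6 * (2 * xi2 t + 3 * xi t).
Let Y0 t : 0 <= Y t.
Proof. by rewrite /Y !mulr_ge0 ?exprn_ge0// addr_ge0// mulr_ge0. Qed.

Let ler_k i j : (i <= j)%N -> kappa ^+ i <= kappa ^+ j.
Proof. by move=> ij; rewrite ler_weXn2l. Qed.

(** * Uniform bounds on states and inputs *)

Section BoundedInputs.
Context (mu : nat -> 'cV[R]_nu) (t : nat).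
Hypothesis mu_le : forall s, (s <= t)%N -> frobn (mu s) <= 2 * kB * kappa ^+ 3 * xi s.

Let forcing_le s : (s < t)%N -> frobn (B *m mu s + w s) <= G s.
Proof.
move=> st; apply: (le_trans (frobnD _ _)); rewrite lerD2r.
have -> : 2 * kB ^+ 2 * kappa ^+ 3 * xi s = kB * (2 * kB * kappa ^+ 3 * xi s) by ring.
by rewrite frobn_mulmxv_le// mu_le// ltnW.
Qed.

Let x n := conv (mxpow AK) n (fun s => B *m mu s + w s) t.

Let filtG : kappa ^+ 2 * filt lam G t =
  2 * kB ^+ 2 * kappa ^+ 5 * xi2 t + kappa ^+ 2 * xi t.
Proof. by rewrite /G filtD filtZ -/xi -/xi2; ring. Qed.

(** With [mu] and [n] arbitrary, one bound serves constant and time-varying parameters, true and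
    truncated memory. *)
Lemma state_le n : frobn (x n) <= Y t.
Proof.
apply: (@le_trans _ _ (kappa ^+ 2 * filt lam G t)).
  by apply: frobn_conv_le; rewrite ?exprn_ge0// => j _; exact: specnorm_pow.
have kB2 : 1 <= kB ^+ 2 by rewrite exprn_ege1.
have e1 : kB ^+ 2 * kappa ^+ 5 * xi2 t <= kB ^+ 2 * kappa ^+ 6 * xi2 t.
  by rewrite ler_wpM2r// ler_wpM2l ?exprn_ge0// ler_k.
have e2 : kappa ^+ 2 * xi t <= kB ^+ 2 * kappa ^+ 6 * xi t.
  rewrite ler_wpM2r// (le_trans (ler_k (isT : 2 <= 6)%N))//.
  by rewrite ler_peMl ?exprn_ge0.
have e3 : 0 <= kB ^+ 2 * kappa ^+ 6 * xi t by rewrite !mulr_ge0 ?exprn_ge0.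
rewrite filtG /Y; lra.
Qed.

Lemma input_le n : frobn (- (K *m x n) + mu t) <= Y t.
Proof.
apply: (le_trans (frobnD _ _)); rewrite frobnN.
have xle : frobn (x n) <= kappa ^+ 2 * filt lam G t.
  by apply: frobn_conv_le; rewrite ?exprn_ge0// => j _; exact: specnorm_pow.
apply: (le_trans (lerD (frobn_mulmxv_le specnormK xle) (mu_le (leqnn t)))).
rewrite filtG /Y.
have h3 : kappa ^+ 3 <= kappa ^+ 6 by exact: ler_k.
have kB2 : kB <= kB ^+ 2 by rewrite expr2 ler_peMl.
have kB2' : 1 <= kB ^+ 2 by apply: le_trans kB2.
have e1 : kappa ^+ 3 * xi t <= kB ^+ 2 * kappa ^+ 6 * xi t.
  by rewrite ler_wpM2r//; apply: (le_trans h3); rewrite ler_peMl ?exprn_ge0.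
have e2 : kB * kappa ^+ 3 * xi t <= kB ^+ 2 * kappa ^+ 6 * xi t.
  by rewrite ler_wpM2r// ler_pM ?exprn_ge0.
have -> : kappa * (2 * kB ^+ 2 * kappa ^+ 5 * xi2 t + kappa ^+ 2 * xi t) =
  2 * (kB ^+ 2 * kappa ^+ 6 * xi2 t) + kappa ^+ 3 * xi t by ring.
(* The coefficient 3 of [xi] in [Y]: one unit from the feedback K x, two from mu t. *)
have -> : kB ^+ 2 * kappa ^+ 6 * (2 * xi2 t + 3 * xi t) =
  2 * (kB ^+ 2 * kappa ^+ 6 * xi2 t) + 3 * (kB ^+ 2 * kappa ^+ 6 * xi t) by ring.
lra.
Qed.

Lemma state_tail n m : (n <= m)%N ->
  frobn (x m - x n) <= kappa ^+ 2 * lam ^+ n * \sum_(s < t) G s.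
Proof.
move=> nm; apply: (frobn_conv_tail (lam := lam)) => //; first exact: exprn_ge0.
by move=> j _; exact: specnorm_pow.
Qed.

End BoundedInputs.

(** * Surrogate costs as functions of the parameter, and their gradients *)

Let mu M := disturbance_input w M.

Let mu_le M s : inM B kappa gamma M -> frobn (mu M s) <= 2 * kB * kappa ^+ 3 * xi s.
Proof.
move=> MM; apply: (frobn_conv_le (lam := lam)) => //.
  by rewrite !mulr_ge0 ?exprn_ge0.
by move=> j jH; exact: (MM (Ordinal jH)).
Qed.

(** The l^2 norm of the window of noise norms, dual to the Frobenius norm of the parameter by
    Cauchy-Schwarz: it measures how the input depends on [M], whereas [xi] measures how large the
    input is. *)
Let r s := Num.sqrt (\sum_(k < H) lag W s k ^+ 2).
Let rho := filt lam r.
Let r0 s : 0 <= r s. Proof. exact: sqrtr_ge0. Qed.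
Let rho0 s : 0 <= rho s. Proof. exact: filt_ge0. Qed.

Let mu_frobn M s : frobn (mu M s) <= frobn M * r s.
Proof.
apply: (le_trans (frobn_sum _ _ _)).
apply: (@le_trans _ _ (\sum_(k < H) frobn (blk M k) * lag W s k)).
  by apply: ler_sum => k _; rewrite (le_trans (frobn_mulmx _ _))// frobn_lag.
rewrite -(@ler_pXn2r _ 2)// ?nnegrE ?mulr_ge0 ?frobn_ge0//; last first.
  by apply: sumr_ge0 => k _; rewrite mulr_ge0 ?frobn_ge0 ?lag_ge0.
apply: (le_trans (ler_sum_sqr _ _ _)).
rewrite exprMn frobn_sqr_blk sqr_sqrtr//.
by apply: sumr_ge0 => k _; rewrite sqr_ge0.
Qed.

Let muD M N s : mu (M + N) s = mu M s + mu N s.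
Proof. by rewrite /mu /disturbance_input /conv -big_split; apply: eq_bigr => k _ /=; rewrite blkD mulmxDl. Qed.

Let muZ l M s : mu (l *: M) s = l *: mu M s.
Proof. by rewrite /mu /disturbance_input /conv scaler_sumr; apply: eq_bigr => k _; rewrite blkZ scalemxAl. Qed.

Let muB M N s : mu (M - N) s = mu M s - mu N s.
Proof. by rewrite -scaleN1r muD muZ scaleN1r. Qed.

(** Separating the part independent of [M] from the linear part exhibits f_t as a convex cost
    composed with an affine map. *)
Let y0 t := conv (mxpow AK) H.+1 w t.
Let Ly t M := conv (mxpow AK) H.+1 (fun s => B *m mu M s) t.
Let Lv t M := - (K *m Ly t M) + mu M t.

Let Ly_linear t : linear (Ly t).
Proof.
move=> l M N; rewrite /Ly -convZ -convD; congr conv; apply/funext => s.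
by rewrite muD muZ mulmxDr scalemxAr.
Qed.

Let Lv_linear t : linear (Lv t).
Proof.
move=> l M N; rewrite /Lv Ly_linear muD muZ mulmxDr -scalemxAr scalerDr scalerN.
by rewrite opprD addrACA.
Qed.

Let yf t M := y0 t + Ly t M.
Let vf t M := - (K *m y0 t) + Lv t M.

Let yfE t M : yf t M = conv (mxpow AK) H.+1 (fun s => B *m mu M s + w s) t.
Proof. by rewrite /yf addrC -convD. Qed.

Let vfE t M : vf t M = - (K *m yf t M) + mu M t.
Proof. by rewrite /vf /yf /Lv mulmxDr opprD addrA. Qed.

Let fsurE t : fsur A B K c w t = (fun M => c t (yf t M) (vf t M)).
Proof. by apply/funext => M; rewrite /fsur /Fsur vsurE ysurE vfE yfE. Qed.

Let q t := rho t + r t.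
(** In the gradient bound [h], the 2 counts the two arguments of the cost, Gc * Y bounds each
    partial gradient, and kappa^3 kB q bounds the operator norms of [Ly] and [Lv]. *)
Let C0 := 2 * Gc * kappa ^+ 3 * kB.
Let h t := C0 * Y t * q t.
Let C00 : 0 <= C0. Proof. by rewrite /C0 !mulr_ge0 ?exprn_ge0. Qed.
Let q0 t : 0 <= q t. Proof. exact: addr_ge0. Qed.
Let h0 t : 0 <= h t. Proof. by rewrite /h mulr_ge0// mulr_ge0. Qed.

Let Ly_le t M : frobn (Ly t M) <= kappa ^+ 2 * kB * frobn M * rho t.
Proof.
have -> : kappa ^+ 2 * kB * frobn M * rho t =
    kappa ^+ 2 * filt lam (fun s => kB * frobn M * r s) t.
  by rewrite filtZ -/rho; ring.
apply: frobn_conv_le => //; rewrite ?exprn_ge0//.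
- by move=> s; rewrite !mulr_ge0 ?frobn_ge0.
- by move=> s _; rewrite -mulrA frobn_mulmxv_le// mu_frobn.
- by move=> j _; exact: specnorm_pow.
Qed.

Let grad_le t M : inM B kappa gamma M -> frobn (grad (fsur A B K c w t) M) <= h t.
Proof.
move=> MM; rewrite fsurE.
pose lyM := GRing.isLinear.Build _ _ _ _ _ (Ly_linear t).
pose ly : {linear _ -> _} := HB.pack (Ly t) lyM.
pose lvM := GRing.isLinear.Build _ _ _ _ _ (Lv_linear t).
pose lv : {linear _ -> _} := HB.pack (Lv t) lvM.
apply: (frobn_grad_comp_affine cA1 (Ly := ly) (Lv := lv)) => // N.
have yY : frobn (y0 t + Ly t M) <= Y t.
  by rewrite -/(yf t M) yfE state_le// => s _; exact: mu_le.
have vY : frobn (- (K *m y0 t) + Lv t M) <= Y t.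
  by rewrite -/(vf t M) vfE yfE input_le// => s _; exact: mu_le.
have kk : kappa ^+ 2 <= kappa ^+ 3 by exact: ler_k.
have ck : kappa ^+ 2 * kB <= kappa ^+ 3 * kB by rewrite ler_wpM2r.
have k3 : 1 <= kappa ^+ 3 * kB by rewrite mulr_ege1// exprn_ege1.
have LyN : frobn (Ly t N) <= kappa ^+ 3 * kB * frobn N * q t.
  apply: (le_trans (Ly_le t N)); rewrite ler_pM ?mulr_ge0 ?exprn_ge0 ?frobn_ge0//.
    by rewrite ler_wpM2r ?frobn_ge0.
  by rewrite /q lerDl.
have LvN : frobn (Lv t N) <= kappa ^+ 3 * kB * frobn N * q t.
  apply: (le_trans (frobnD _ _)); rewrite frobnN /q mulrDr lerD//.
    apply: (le_trans (frobn_mulmxv_le specnormK (Ly_le t N))).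
    by lra.
  by apply: (le_trans (mu_frobn N t)); rewrite ler_wpM2r// ler_peMl ?frobn_ge0.
rewrite /=.
apply: (@le_trans _ _ (Gc * (Y t * (kappa ^+ 3 * kB * frobn N * q t) +
                             Y t * (kappa ^+ 3 * kB * frobn N * q t)))).
  by rewrite ler_wpM2l// lerD// ler_pM ?frobn_ge0.
by rewrite /h /C0; lra.
Qed.

Let f_convex t M N :
  fsur A B K c w t M - fsur A B K c w t N <= dotm (grad (fsur A B K c w t) M) (M - N).
Proof.
rewrite fsurE.
pose lyM := GRing.isLinear.Build _ _ _ _ _ (Ly_linear t).
pose ly : {linear _ -> _} := HB.pack (Ly t) lyM.
pose lvM := GRing.isLinear.Build _ _ _ _ _ (Lv_linear t).
pose lv : {linear _ -> _} := HB.pack (Lv t) lvM.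
exact: (grad_comp_affine_convex cA1 _ _ ly lv).
Qed.

(** * Projected gradient descent, memory and truncation *)

Section Algorithm.
Context (eta : R) (M0 : 'M[R]_(nu, H * nx)) (T : nat).
Hypotheses (eta0 : 0 < eta) (M0in : inM B kappa gamma M0).

Let M t := (dap_state A B K kappa gamma eta c w M0 t).2.
Let x t := (dap_state A B K kappa gamma eta c w M0 t).1.
Let f t : 'M[R]_(nu, H * nx) -> R := fsur A B K c w t.

Let gamma1 : gamma <= 1. Proof. by case/andP: gamma01 => _ /ltW. Qed.

Let M_in t : inM B kappa gamma (M t).
Proof. by case: t => [|t] //=; exact: inM_projM. Qed.

Let M_step t : frobn (M t.+1 - M t) <= eta * h t.
Proof.
apply: (le_trans (projM_le kappa0 gamma1 _ (M_in t))).
rewrite addrAC subrr add0r frobnN frobnZ gtr0_norm// ler_wpM2l ?(ltW eta0)//.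
exact: (grad_le t (M_in t)).
Qed.

Let ogd_step t N : inM B kappa gamma N ->
  f t (M t) - f t N <=
  (frobn (M t - N) ^+ 2 - frobn (M t.+1 - N) ^+ 2) / (2 * eta) + eta / 2 * h t ^+ 2.
Proof.
move=> NM; apply: (le_trans (f_convex t (M t) N)).
set g := grad _ _; set d := dotm _ _.
have gh : frobn g ^+ 2 <= h t ^+ 2 by rewrite lerXn2r ?nnegrE ?frobn_ge0//; exact: (grad_le t (M_in t)).
have : frobn (M t.+1 - N) ^+ 2 <= frobn (M t - eta *: g - N) ^+ 2.
  by rewrite lerXn2r ?nnegrE ?frobn_ge0//; exact: projM_le.
rewrite addrAC [leRHS]frobn_sqrD frobnN frobnZ dotmNr dotmZr dotmC -/d (gtr0_norm eta0) => le1.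
have e0 : 0 < 2 * eta by rewrite mulr_gt0.
rewrite -(ler_pM2l e0) mulrDr mulrCA divff ?gt_eqF// mulr1.
have := ler_wpM2l (sqr_ge0 eta) gh; move: le1; rewrite exprMn.
have -> : 2 * eta * (eta / 2 * h t ^+ 2) = eta ^+ 2 * h t ^+ 2 by field.
lra.
Qed.

Let ogd_sum N : inM B kappa gamma N ->
  \sum_(t < T) (f t (M t) - f t N) <=
  frobn (M0 - N) ^+ 2 / (2 * eta) + eta / 2 * \sum_(t < T) h t ^+ 2.
Proof.
move=> NM.
(* The final squared distance is kept so that the induction telescopes. *)
suff : \sum_(t < T) (f t (M t) - f t N) <=
    (frobn (M0 - N) ^+ 2 - frobn (M T - N) ^+ 2) / (2 * eta) +
    eta / 2 * \sum_(t < T) h t ^+ 2.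
  move/le_trans; apply; rewrite lerD2r ler_wpM2r ?invr_ge0 ?mulr_ge0 ?(ltW eta0)//.
  by rewrite gerBl sqr_ge0.
elim: T => [|t ih]; first by rewrite !big_ord0 subrr mul0r mulr0 addr0.
rewrite !big_ord_recr; apply: (le_trans (lerD ih (ogd_step t NM))).
set a := frobn (M t.+1 - N) ^+ 2; rewrite /=; lra.
Qed.

(* The drift M s - M t is a sum of steps of size eta * h; summing by parts inside
   the filter charges each step to the filtered weight rho at its own time. *)
Let drift t : filt lam (fun s => frobn (M s - M t) * r s) t <=
  eta * filt lam (fun s => h s * q s) t.
Proof.
elim: t => [|t ih] /=; first by rewrite mulr0.
apply: (@le_trans _ _ (lam * (filt lam (fun s => frobn (M s - M t) * r s) t +
    eta * h t * rho t) + eta * h t * r t)).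
  apply: lerD; last by rewrite ler_wpM2r// frobnBC M_step.
  rewrite ler_wpM2l// -filtZ -filtD; apply: ler_filt => // s _.
  rewrite -mulrDl ler_wpM2r//.
  have -> : M s - M t.+1 = M s - M t - (M t.+1 - M t).
    by rewrite opprB addrA subrK.
  by apply: (le_trans (frobnB _ _)); rewrite lerD2l M_step.
have := ler_wpM2l lam0 ih.
have : lam * (eta * h t * rho t) <= eta * h t * rho t.
  by rewrite ler_piMl ?(ltW lam1)// mulr_ge0// mulr_ge0// ltW.
by rewrite /q; lra.
Qed.

Let g s := B *m mu (M s) s + w s.
Let y t := conv (mxpow AK) H.+1 g t.
Let v t := - (K *m y t) + mu (M t) t.
Let SG := \sum_(s < T) G s.

Let xE n t : (t <= n)%N -> x t = conv (mxpow AK) n g t.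
Proof.
apply: conv_recurrence => // s; rewrite /x /= -/(x s) dap_inputE -/(M s).
by rewrite mulmxDr mulmxN mulmxBl !addrA mulmxA.
Qed.

Let sum_le (F : nat -> R) t : (forall s, 0 <= F s) -> (t < T)%N ->
  \sum_(s < t) F s <= \sum_(s < T) F s.
Proof.
move=> F0 tT; rewrite -!(big_mkord xpredT F) [leRHS](big_cat_nat (n := t))//=; last exact: ltnW.
by rewrite lerDl sumr_ge0.
Qed.

Let SG0 : 0 <= SG. Proof. by apply: sumr_ge0. Qed.

Let truncation_le t : (t < T)%N ->
  c t (x t) (- (K *m x t) + mu (M t) t) - c t (y t) (v t) <=
  2 * Gc * kappa ^+ 3 * lam ^+ H * SG * Y t.
Proof.
move=> tT; apply: (le_trans (cost_diff_le cA1 _ _ _ _ _)).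
have muM s : (s <= t)%N -> frobn (mu (M s) s) <= 2 * kB * kappa ^+ 3 * xi s.
  by move=> _; exact: mu_le.
have xE' := xE (leq_maxr H.+1 t); rewrite xE'.
have xy : frobn (conv (mxpow AK) (maxn H.+1 t) g t - y t) <= kappa ^+ 2 * lam ^+ H * SG.
  apply: (le_trans (state_tail muM (leq_maxl _ _))).
  rewrite ler_pM ?mulr_ge0 ?exprn_ge0 ?sumr_ge0//; last exact: sum_le.
  by rewrite ler_wpM2l ?exprn_ge0// exprS ler_piMl ?exprn_ge0// ltW.
have uv : frobn (- (K *m conv (mxpow AK) (maxn H.+1 t) g t) + mu (M t) t - v t) <=
    kappa * (kappa ^+ 2 * lam ^+ H * SG).
  by rewrite /v opprD addrACA subrr addr0 opprK addrC -mulmxBr frobn_mulmxv_le// frobnBC.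
have e0 : 0 <= kappa ^+ 2 * lam ^+ H * SG by rewrite !mulr_ge0 ?exprn_ge0.
apply: (@le_trans _ _ (Gc * (Y t * (kappa * (kappa ^+ 2 * lam ^+ H * SG)) +
   Y t * (kappa * (kappa ^+ 2 * lam ^+ H * SG))))).
  rewrite ler_wpM2l// lerD// ler_pM ?frobn_ge0 ?state_le ?input_le//.
  by apply: (le_trans xy); rewrite ler_peMl.
lra.
Qed.

(** Both sides have the same truncation, so the states differ only through M s - M t filtered by the
    closed loop, which is what [drift] controls. *)
Let memory_le t : c t (y t) (v t) - f t (M t) <=
  eta * (C0 * Y t * filt lam (fun s => h s * q s) t).
Proof.
rewrite /f fsurE; apply: (le_trans (cost_diff_le cA1 _ _ _ _ _)).
have muM s : (s <= t)%N -> frobn (mu (M s) s) <= 2 * kB * kappa ^+ 3 * xi s.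
  by move=> _; exact: mu_le.
set d := eta * filt lam (fun s => h s * q s) t.
have yy : frobn (y t - yf t (M t)) <= kappa ^+ 2 * kB * d.
  rewrite yfE convB; apply: (@le_trans _ _ (kappa ^+ 2 *
    filt lam (fun s => kB * (frobn (M s - M t) * r s)) t)).
    apply: frobn_conv_le => //; rewrite ?exprn_ge0//.
    - by move=> s; rewrite !mulr_ge0 ?frobn_ge0.
    - move=> s _; rewrite /g opprD addrACA subrr addr0 -mulmxBr -muB.
      by rewrite frobn_mulmxv_le// mu_frobn.
    - by move=> j _; exact: specnorm_pow.
  by rewrite filtZ -[leRHS]mulrA ler_wpM2l ?exprn_ge0// ler_wpM2l//; exact: drift.
have vv : frobn (v t - vf t (M t)) <= kappa * (kappa ^+ 2 * kB * d).
  rewrite vfE /v opprD addrACA subrr addr0 opprK addrC -mulmxBr.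
  by rewrite frobn_mulmxv_le// frobnBC.
have d0 : 0 <= kappa ^+ 2 * kB * d.
  by apply: le_trans yy; rewrite frobn_ge0.
apply: (@le_trans _ _ (Gc * (Y t * (kappa * (kappa ^+ 2 * kB * d)) +
   Y t * (kappa * (kappa ^+ 2 * kB * d))))).
  rewrite ler_wpM2l// lerD// ler_pM ?frobn_ge0 ?state_le ?input_le//.
  by apply: (le_trans yy); rewrite ler_peMl.
rewrite /d /C0; lra.
Qed.

(** * Comparison with a linear policy *)

Section Comparator.
Context (K' : 'M[R]_(nu, nx)) (K'st : strongly_stable A B kappa gamma K').

Let AK' := A - B *m K'.
Let x' := lin_state A B K' w.
Let mu' s := (K - K') *m x' s.
Let F k := (K - K') *m mxpow AK' k.
(* The comparator obeys x' = (A - B K) x' + B mu' + w with mu' = (K - K') x', and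
   mu' is the full-memory response with kernel F; M' keeps its first H terms. *)
Let M' : 'M[R]_(nu, H * nx) :=
  \matrix_(a < nu, p < H * nx) mxvec (\matrix_(k < H, b < nx) F k a b) 0 p.

Let blkM' k : (k < H)%N -> blk M' k = F k.
Proof.
move=> kH; apply/matrixP => a b; rewrite -[k]/(nat_of_ord (Ordinal kH)) blkE.
by rewrite mxE mxvecE mxE.
Qed.

Let F_le k : specnorm (F k) <= 2 * kappa ^+ 3 * lam ^+ k.
Proof.
apply: specnorm_le_scale => [|z]; first by rewrite !mulr_ge0 ?exprn_ge0.
rewrite /F -mulmxA mulmxBl.
have zk : frobn (mxpow AK' k *m z) <= kappa ^+ 2 * lam ^+ k * frobn z.
  by rewrite frobn_mulmxv_le// specnorm_pow.
have K'k : specnorm K' <= kappa by case: K'st => P [Q []].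
apply: (le_trans (frobnB _ _)).
have := frobn_mulmxv_le specnormK zk; have := frobn_mulmxv_le K'k zk; lra.
Qed.

Let M'_in : inM B kappa gamma M'.
Proof.
move=> k; rewrite blkM'//; apply: (le_trans (F_le k)).
rewrite ler_wpM2r ?exprn_ge0// -/kB ler_wpM2r ?exprn_ge0//.
by rewrite ler_peMr.
Qed.

Let x'E n t : (t <= n)%N -> x' t = conv (mxpow AK') n w t.
Proof.
apply: conv_recurrence => // s.
by rewrite /x' /= mulmxBl mulmxN mulmxA.
Qed.

Let mu'E n t : (t <= n)%N -> mu' t = conv F n w t.
Proof.
move=> tn; rewrite /mu' (x'E tn) /conv mulmx_sumr; apply: eq_bigr => j _.
by rewrite mulmxA.
Qed.

Let mu'_le s : frobn (mu' s) <= 2 * kB * kappa ^+ 3 * xi s.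
Proof.
rewrite (mu'E (leqnn s)); apply: (@le_trans _ _ (2 * kappa ^+ 3 * xi s)).
  by apply: frobn_conv_le; rewrite // !mulr_ge0 ?exprn_ge0.
by rewrite ler_wpM2r// ler_wpM2r ?exprn_ge0// ler_peMr.
Qed.

Let SW := \sum_(s < T) W s.
Let SW0 : 0 <= SW. Proof. exact: sumr_ge0. Qed.

Let mu'_tail s : (s < T)%N -> frobn (mu M' s - mu' s) <= 2 * kappa ^+ 3 * lam ^+ H * SW.
Proof.
move=> sT; rewrite frobnBC (mu'E (leq_maxr H s)).
have -> : mu M' s = conv F H w s by apply: eq_conv => // j jH; exact: blkM'.
have k0 : 0 <= 2 * kappa ^+ 3 by rewrite mulr_ge0 ?exprn_ge0.
apply: (le_trans (frobn_conv_tail (lam := lam) (G := W) k0 _ _ _ _ (leq_maxl _ _) _)) => //.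
by rewrite ler_wpM2l ?mulr_ge0 ?exprn_ge0// sum_le.
Qed.

Let x'E2 n t : (t <= n)%N -> x' t = conv (mxpow AK) n (fun s => B *m mu' s + w s) t.
Proof.
apply: conv_recurrence => // s; rewrite /mu' -/(x' s) /= addrA; congr (_ + _).
by rewrite -/(x' s) mulmxA -mulmxDl mulmxN mulmxA -mulmxBl mulmxBr addrA subrK.
Qed.

(** Three errors: the memory of the comparator's state is cut ([SG]); its input is cut to [H] terms,
    an error uniform in time that costs 1 / gamma through the filter; and the same cut enters
    directly in the input (the last [SW] term). *)
Let comparator_le t : (t < T)%N ->
  f t M' - c t (x' t) (- (K' *m x' t)) <=
  2 * Gc * kappa ^+ 3 * lam ^+ H * (SG + 2 * kB * kappa ^+ 3 / gamma * SW +
     kappa ^+ 3 * SW) * Y t.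
Proof.
move=> tT; rewrite /f fsurE.
have -> : - (K' *m x' t) = - (K *m x' t) + mu' t.
  by rewrite /mu' mulmxBl addrA addNr add0r.
apply: (le_trans (cost_diff_le cA1 _ _ _ _ _)).
set e1 := lam ^+ H * SG; set e2 := lam ^+ H * SW.
have e10 : 0 <= e1 by rewrite mulr_ge0 ?exprn_ge0.
have e20 : 0 <= e2 by rewrite mulr_ge0 ?exprn_ge0.
have yx : frobn (yf t M' - x' t) <=
    kappa ^+ 2 * e1 + kappa ^+ 2 * (2 * kB * kappa ^+ 3 / gamma * e2).
  rewrite (x'E2 (leq_maxr H.+1 t)) yfE.
  set xm := conv _ (maxn _ _) _ _.
  (* Intermediate state: truncated memory but the exact comparator input, which separates the first
     two errors. *)
  pose yn := conv (mxpow AK) H.+1 (fun s => B *m mu' s + w s) t.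
  have -> : conv (mxpow AK) H.+1 (fun s => B *m mu M' s + w s) t - xm =
     - (xm - yn) + conv (mxpow AK) H.+1 (fun s => B *m (mu M' s - mu' s)) t.
    have -> : (fun s => B *m (mu M' s - mu' s)) =
        (fun s => B *m mu M' s + w s - (B *m mu' s + w s)).
      by apply/funext => s; rewrite opprD addrACA subrr addr0 mulmxBr.
    by rewrite -convB -/yn opprB [RHS]addrC addrA subrK.
  apply: (le_trans (frobnD _ _)); rewrite frobnN lerD//.
    apply: (le_trans (state_tail _ (leq_maxl _ _))); first by move=> s _; exact: mu'_le.
    rewrite /e1 -mulrA ler_wpM2l ?exprn_ge0//.
    rewrite ler_pM ?exprn_ge0 ?sumr_ge0//; last exact: sum_le.
    by rewrite exprS ler_piMl ?exprn_ge0// ltW.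
  have b0 : 0 <= kB * (2 * kappa ^+ 3 * e2) by rewrite !mulr_ge0 ?exprn_ge0.
  apply: (@le_trans _ _ (kappa ^+ 2 * filt lam (fun=> kB * (2 * kappa ^+ 3 * e2)) t)).
    apply: frobn_conv_le => //; rewrite ?exprn_ge0//.
    - by move=> s st; rewrite frobn_mulmxv_le// mulrA mu'_tail// (ltn_trans st).
    - by move=> j _; exact: specnorm_pow.
  rewrite ler_wpM2l ?exprn_ge0//; apply: (le_trans (filt_cst_le _ lam0 lam1 b0)).
  by rewrite lamE; lra.
have vu : frobn (vf t M' - (- (K *m x' t) + mu' t)) <=
   kappa * (kappa ^+ 2 * e1 + kappa ^+ 2 * (2 * kB * kappa ^+ 3 / gamma * e2)) +
   2 * kappa ^+ 3 * e2.
  rewrite vfE opprD addrACA opprK; apply: (le_trans (frobnD _ _)); rewrite lerD//.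
    by rewrite addrC -mulmxBr frobn_mulmxv_le// frobnBC.
  by rewrite mulrA mu'_tail.
have yY : frobn (yf t M') <= Y t by rewrite yfE state_le// => s _; exact: mu_le.
have vY : frobn (vf t M') <= Y t by rewrite vfE yfE input_le// => s _; exact: mu_le.
set e := kappa ^+ 2 * e1 + _ in yx vu.
have eE : e = kappa ^+ 2 * (e1 + 2 * kB * kappa ^+ 3 / gamma * e2) by rewrite /e; ring.
have e0 : 0 <= e by apply: le_trans yx; exact: frobn_ge0.
apply: (@le_trans _ _ (Gc * (Y t * (kappa * e) + Y t * (kappa * e + 2 * kappa ^+ 3 * e2)))).
  rewrite ler_wpM2l// lerD// ler_pM ?frobn_ge0//.
  by apply: (le_trans yx); rewrite ler_peMl.
have k63 : kappa ^+ 3 <= kappa ^+ 6 by exact: ler_k.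
have : 0 <= Gc * Y t * e2 * (kappa ^+ 6 - kappa ^+ 3).
  by rewrite mulr_ge0 ?subr_ge0// mulr_ge0// mulr_ge0.
rewrite eE /e1 /e2; lra.
Qed.

Let regret_decomposition :
  J_dap A B K kappa gamma eta c w M0 T - J_lin A B K' c w T <=
  frobn (M0 - M') ^+ 2 / (2 * eta) + eta / 2 * \sum_(t < T) h t ^+ 2 +
  eta * \sum_(t < T) C0 * Y t * filt lam (fun s => h s * q s) t +
  2 * Gc * kappa ^+ 3 * lam ^+ H * (2 * SG + 2 * kB * kappa ^+ 3 / gamma * SW +
     kappa ^+ 3 * SW) * \sum_(t < T) Y t.
Proof.
have -> : J_dap A B K kappa gamma eta c w M0 T =
    \sum_(t < T) c t (x t) (- (K *m x t) + mu (M t) t).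
  by apply: eq_bigr => t _; rewrite /mu -dap_inputE.
have -> : J_lin A B K' c w T = \sum_(t < T) c t (x' t) (- (K' *m x' t)) by [].
have h1 := ler_sum (index_enum 'I_T) (fun (t : 'I_T) (_ : xpredT t) => truncation_le (ltn_ord t)).
have h2 := ler_sum (index_enum 'I_T) (fun (t : 'I_T) (_ : xpredT t) => memory_le t).
have h3 := ogd_sum M'_in.
have h4 := ler_sum (index_enum 'I_T) (fun (t : 'I_T) (_ : xpredT t) => comparator_le (ltn_ord t)).
move: h1 h2 h3 h4; rewrite !sumrB -!mulr_sumr; lra.
Qed.

Let diameter_le : frobn (M0 - M') ^+ 2 <= 16 * nx%:R * kB ^+ 2 * kappa ^+ 6 / gamma ^+ 2.
Proof.
pose S := \sum_(k < H) nx%:R * (2 * kB * kappa ^+ 3 * lam ^+ k) ^+ 2.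
have S_le : S <= 4 * nx%:R * kB ^+ 2 * kappa ^+ 6 / gamma ^+ 2.
  have -> : S = 4 * nx%:R * kB ^+ 2 * kappa ^+ 6 * \sum_(k < H) lam ^+ k ^+ 2.
    by rewrite mulr_sumr; apply: eq_bigr => k _; ring.
  rewrite ler_wpM2l ?mulr_ge0 ?exprn_ge0//.
  apply: (@le_trans _ _ (\sum_(k < H) lam ^+ k)).
    apply: ler_sum => k _; rewrite expr2 ler_piMl ?exprn_ge0//.
    by rewrite exprn_ile1// ltW.
  apply: (@le_trans _ _ gamma^-1).
    rewrite -[leRHS]mul1r ler_pdivlMr// mulrC.
    have := subrX1 lam H; have := exprn_ge0 H lam0; rewrite /lam; lra.
  (* The geometric sum gives gamma^-1, weakened to gamma^-2 to match [Dconst] squared. *)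
  rewrite lef_pV2 ?posrE ?exprn_gt0// expr2 ler_piMr ?(ltW gamma0)//.
have aS : frobn M0 ^+ 2 <= S by exact: inM_frobn.
have bS : frobn M' ^+ 2 <= S by exact: inM_frobn.
have : frobn (M0 - M') ^+ 2 <= (frobn M0 + frobn M') ^+ 2.
  by rewrite lerXn2r ?nnegrE ?addr_ge0 ?frobn_ge0// frobnB.
have := sqr_ge0 (frobn M0 - frobn M'); lra.
Qed.

(** * Reduction to the sum of fourth powers of the noise *)

Let Z := \sum_(t < T) W t ^+ 4.
Let Z0 : 0 <= Z. Proof. by apply: sumr_ge0 => t _; rewrite exprn_ge0. Qed.

Let sum_xi4 : \sum_(t < T) xi t ^+ 4 <= Z / gamma ^+ 4.
Proof. by rewrite -lamE; exact: sum_filt_pow4. Qed.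

Let gamma4_le1 : gamma ^+ 4 <= 1.
Proof. by rewrite exprn_ile1// ltW. Qed.

Let sum_xi24 : \sum_(t < T) xi2 t ^+ 4 <= Z / gamma ^+ 8.
Proof.
rewrite -[8%N]/(4 + 4)%N exprD invfM mulrA.
apply: (@le_trans _ _ ((\sum_(t < T) xi t ^+ 4) / gamma ^+ 4)).
  by rewrite -[in leRHS]lamE; exact: sum_filt_pow4.
by rewrite ler_wpM2r// invr_ge0 exprn_ge0// ltW.
Qed.

(* Normalizations making the fourth moments of Y / cY and q / sqrt cq at most Z. *)
Let cY := 5 * kB ^+ 2 * kappa ^+ 6 / gamma ^+ 2.
Let a t := Y t / cY.

Let cY_gt0 : 0 < cY.
Proof.
have kp : 0 < kappa by apply: lt_le_trans kappa1.
have kBp : 0 < kB by apply: lt_le_trans kB1.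
by rewrite /cY divr_gt0 ?exprn_gt0// !mulr_gt0 ?exprn_gt0.
Qed.

Let YE t : Y t = cY * a t.
Proof. by rewrite /a mulrC divfK ?gt_eqF. Qed.

Let a0 t : 0 <= a t. Proof. by rewrite /a divr_ge0// ltW. Qed.

Let sum_a4 : \sum_(t < T) a t ^+ 4 <= Z.
Proof.
have aE t : a t ^+ 4 <= gamma ^+ 8 * (2 / 5 * xi2 t ^+ 4 + 3 / 5 * xi t ^+ 4).
  (* The 5 in [cY] turns the weights 2 and 3 of [Y] into a convex combination; the gamma^2 raised to
     the fourth power pays for the double filter in [xi2]. *)
  have -> : a t = gamma ^+ 2 * (2 / 5 * xi2 t + (1 - 2 / 5) * xi t).
    have kp : kappa != 0 by rewrite gt_eqF// (lt_le_trans _ kappa1).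
    have kBp : kB != 0 by rewrite gt_eqF// (lt_le_trans _ kB1).
    rewrite /a /cY /Y; field.
    by rewrite kp kBp gt_eqF.
  rewrite exprMn -exprM ler_wpM2l ?exprn_ge0 ?(ltW gamma0)//.
  have -> : 3 / 5 = 1 - 2 / 5 :> R by field.
  by apply: pow4_convex; apply/andP; split; lra.
apply: (le_trans (ler_sum _ (fun (t : 'I_T) _ => aE t))).
rewrite -mulr_sumr big_split /= -!mulr_sumr.
have g8 : 0 < gamma ^+ 8 by rewrite exprn_gt0.
rewrite mulrC -ler_pdivlMr//.
have : Z / gamma ^+ 4 <= Z / gamma ^+ 8.
  rewrite ler_wpM2l// lef_pV2 ?posrE ?exprn_gt0//.
  by rewrite -[8%N]/(4 + 4)%N exprD ler_piMl// exprn_ge0// ltW.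
have := sum_xi4; have := sum_xi24; lra.
Qed.

Hypothesis H_gt0 : (0 < H)%N.

Let cq := 4 * H%:R / gamma ^+ 2.
Let b t := q t ^+ 2 / cq.

Let cq_gt0 : 0 < cq.
Proof. by rewrite /cq divr_gt0 ?exprn_gt0// mulr_gt0 ?ltr0n. Qed.

Let qE t : q t ^+ 2 = cq * b t.
Proof. by rewrite /b mulrC divfK ?gt_eqF. Qed.

(** Cauchy-Schwarz over the window gives one factor [H]; summing [H] shifted copies of the noise
    over time gives the other. *)
Let sum_r4 : \sum_(t < T) r t ^+ 4 <= H%:R ^+ 2 * Z.
Proof.
have rE t : r t ^+ 4 <= H%:R * \sum_(k < H) lag (fun s => W s ^+ 4) t k.
  rewrite -[4%N]/(2 * 2)%N exprM sqr_sqrtr; last by apply: sumr_ge0 => k _; rewrite sqr_ge0.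
  have := ler_sum_sqr (index_enum 'I_H) (fun=> 1) (fun k : 'I_H => lag W t k ^+ 2).
  under eq_bigr do rewrite mul1r.
  under [X in _ <= X * _]eq_bigr do rewrite expr1n.
  rewrite sumr_const card_ord => /le_trans; apply; rewrite ler_wpM2l//.
  apply: ler_sum => k _; rewrite -exprM /lag; case: ifP => // _.
  by rewrite expr0n.
apply: (le_trans (ler_sum _ (fun (t : 'I_T) _ => rE t))).
rewrite -mulr_sumr expr2 -mulrA ler_wpM2l// exchange_big /=.
rewrite mulr_natl -[X in _ *+ X]card_ord -sumr_const; apply: ler_sum => k _.
by apply: sum_lag_time => s; rewrite exprn_ge0.
Qed.

Let sum_b2 : \sum_(t < T) b t ^+ 2 <= Z.
Proof.
have H0 : H%:R != 0 :> R by rewrite pnatr_eq0 -lt0n.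
have g0 : gamma != 0 by rewrite gt_eqF.
have bE t : b t ^+ 2 <= gamma ^+ 4 / H%:R ^+ 2 * (1 / 2 * rho t ^+ 4 + 1 / 2 * r t ^+ 4).
  (* The 4 in [cq] makes q / 2 the midpoint of [rho] and [r], ready for convexity. *)
  have -> : b t ^+ 2 = gamma ^+ 4 / H%:R ^+ 2 * (1 / 2 * rho t + (1 - 1 / 2) * r t) ^+ 4.
    by rewrite /b /cq /q; field; rewrite H0 g0.
  rewrite ler_wpM2l ?divr_ge0 ?exprn_ge0 ?(ltW gamma0)//.
  have -> : 1 / 2 * rho t ^+ 4 + 1 / 2 * r t ^+ 4 =
      1 / 2 * rho t ^+ 4 + (1 - 1 / 2) * r t ^+ 4 by field.
  by apply: pow4_convex; apply/andP; split; lra.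
apply: (le_trans (ler_sum _ (fun (t : 'I_T) _ => bE t))).
rewrite -mulr_sumr big_split /= -!mulr_sumr.
have rho4 : \sum_(t < T) rho t ^+ 4 <= H%:R ^+ 2 * Z / gamma ^+ 4.
  apply: (@le_trans _ _ ((\sum_(t < T) r t ^+ 4) / gamma ^+ 4)).
    by rewrite -lamE; exact: sum_filt_pow4.
  by rewrite ler_wpM2r// invr_ge0 exprn_ge0// ltW.
have r4 : \sum_(t < T) r t ^+ 4 <= H%:R ^+ 2 * Z / gamma ^+ 4.
  apply: (le_trans sum_r4); rewrite ler_peMr ?mulr_ge0 ?exprn_ge0//.
  by rewrite invf_ge1// exprn_gt0.
have -> : Z = gamma ^+ 4 / H%:R ^+ 2 * (H%:R ^+ 2 * Z / gamma ^+ 4).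
  by field; rewrite H0 g0.
rewrite ler_wpM2l ?divr_ge0 ?exprn_ge0 ?(ltW gamma0)//; lra.
Qed.

Let b0 t : 0 <= b t. Proof. by rewrite /b divr_ge0 ?exprn_ge0// ltW. Qed.

Let c0 : 0 <= C0 ^+ 2 * cY ^+ 2 * cq.
Proof. by rewrite mulr_ge0 ?(ltW cq_gt0)// mulr_ge0 ?sqr_ge0. Qed.

Let sum_h2 : \sum_(t < T) h t ^+ 2 <= C0 ^+ 2 * cY ^+ 2 * cq * Z.
Proof.
have hE t : h t ^+ 2 <= C0 ^+ 2 * cY ^+ 2 * cq * (a t ^+ 4 / 2 + b t ^+ 2 / 2).
  have -> : h t ^+ 2 = C0 ^+ 2 * cY ^+ 2 * cq * (a t ^+ 2 * b t).
    have -> : h t ^+ 2 = (C0 * Y t) ^+ 2 * q t ^+ 2 by rewrite /h; ring.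
    by rewrite qE YE; ring.
  by rewrite ler_wpM2l//; have := sqr_ge0 (a t ^+ 2 - b t); lra.
apply: (le_trans (ler_sum _ (fun (t : 'I_T) _ => hE t))).
rewrite -mulr_sumr ler_wpM2l// big_split /= -!mulr_suml.
have := sum_a4; have := sum_b2; lra.
Qed.

(** The summand mixes two times. Young's inequality twice gives a_t a_s b_s <= a_t^4 / 4 + a_s^4 / 4
    + b_s^2 / 2; [mul_filt_le] keeps the first term outside the filter, and the weights add up to
    1. *)
Let sum_memory : \sum_(t < T) C0 * Y t * filt lam (fun s => h s * q s) t <=
  C0 ^+ 2 * cY ^+ 2 * cq * (Z / gamma).
Proof.
pose e s := a s ^+ 4 / 4 + b s ^+ 2 / 2.
have e0 s : 0 <= e s by rewrite addr_ge0 ?divr_ge0 ?sqr_ge0 ?exprn_even_ge0.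
have tE t : C0 * Y t * filt lam (fun s => h s * q s) t <=
    C0 ^+ 2 * cY ^+ 2 * cq * (a t ^+ 4 / 4 / gamma + filt lam e t).
  have -> : (fun s => h s * q s) = (fun s => C0 * cY * cq * (a s * b s)).
    apply/funext => s.
    have -> : h s * q s = C0 * Y s * q s ^+ 2 by rewrite /h; ring.
    by rewrite qE YE; ring.
  rewrite filtZ.
  have -> : C0 * Y t * (C0 * cY * cq * filt lam (fun s => a s * b s) t) =
     C0 ^+ 2 * cY ^+ 2 * cq * (a t * filt lam (fun s => a s * b s) t).
    by rewrite YE; ring.
  rewrite ler_wpM2l// -lamE; apply: mul_filt_le => //.
    by rewrite divr_ge0 ?exprn_even_ge0.
  move=> s _; rewrite /e.
  have := sqr_ge0 (a t * a s - b s); have := sqr_ge0 (a t ^+ 2 - a s ^+ 2); lra.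
apply: (le_trans (ler_sum _ (fun (t : 'I_T) _ => tE t))).
rewrite -mulr_sumr ler_wpM2l// big_split /=.
have : \sum_(t < T) filt lam e t <= (\sum_(t < T) e t) / gamma.
  by rewrite -lamE; exact: sum_filt_le.
have gi : 0 < gamma^-1 by rewrite invr_gt0.
rewrite -!mulr_suml big_split /= -!mulr_suml.
have := ler_wpM2r (ltW gi) sum_a4; have := ler_wpM2r (ltW gi) sum_b2; lra.
Qed.

Let sum_xi : \sum_(t < T) xi t <= SW / gamma.
Proof. by rewrite -lamE; exact: sum_filt_le. Qed.

Let invgamma_ge1 : 1 <= gamma^-1. Proof. by rewrite invf_ge1. Qed.

Let sum_Y : \sum_(t < T) Y t <= cY * SW.
Proof.
have xi2_le : \sum_(t < T) xi2 t <= SW / gamma ^+ 2.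
  rewrite expr2 invfM mulrA; apply: (@le_trans _ _ ((\sum_(t < T) xi t) / gamma)).
    by rewrite -lamE; exact: sum_filt_le.
  by rewrite ler_wpM2r// invr_ge0 ltW.
have xi_le : \sum_(t < T) xi t <= SW / gamma ^+ 2.
  apply: (le_trans sum_xi); rewrite expr2 invfM mulrA ler_peMr//.
  by rewrite divr_ge0// ltW.
rewrite -mulr_sumr big_split /= -!mulr_sumr /cY.
have -> : 5 * kB ^+ 2 * kappa ^+ 6 / gamma ^+ 2 * SW =
  kB ^+ 2 * kappa ^+ 6 * (5 * (SW / gamma ^+ 2)) by ring.
by rewrite ler_wpM2l ?mulr_ge0 ?exprn_ge0//; lra.
Qed.

(** Here 9 = 2 * 3 + 2 + 1, with SG at most three times the common majorant [Q]. *)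
Let truncation_factor :
  2 * SG + 2 * kB * kappa ^+ 3 / gamma * SW + kappa ^+ 3 * SW <=
  9 * kB ^+ 2 * kappa ^+ 3 / gamma * SW.
Proof.
set Q := kB ^+ 2 * kappa ^+ 3 / gamma * SW.
have gi0 : 0 <= gamma^-1 by rewrite invr_ge0 ltW.
have kB2 : kB <= kB ^+ 2 by rewrite expr2 ler_peMl.
have kB2' : 1 <= kB ^+ 2 by rewrite exprn_ege1.
have Q2 : kB * kappa ^+ 3 / gamma * SW <= Q.
  by rewrite ler_wpM2r// ler_wpM2r// ler_wpM2r ?exprn_ge0.
have Q1 : kappa ^+ 3 * SW <= Q.
  rewrite ler_wpM2r//; apply: (@le_trans _ _ (kB ^+ 2 * kappa ^+ 3)).
    by rewrite ler_peMl ?exprn_ge0.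
  by rewrite ler_peMr// mulr_ge0 ?exprn_ge0.
have Q0 : SW <= Q.
  apply: le_trans Q1; rewrite ler_peMl// exprn_ege1//.
have SGq : SG <= 3 * Q.
  rewrite /SG big_split /= -mulr_sumr.
  have := ler_wpM2l (mulr_ge0 (exprn_ge0 2 kB0) (exprn_ge0 3 kappa0)) sum_xi.
  by move: Q0; rewrite -/SW /Q; lra.
by move: SGq Q1 Q2; rewrite /Q; lra.
Qed.

Lemma dap_regret_le :
  J_dap A B K kappa gamma eta c w M0 T - J_lin A B K' c w T <=
  16 * nx%:R * kB ^+ 2 * kappa ^+ 6 / gamma ^+ 2 / (2 * eta) +
  600 * eta * Gc ^+ 2 * kB ^+ 6 * kappa ^+ 18 * H%:R / gamma ^+ 7 * Z +
  90 * Gc * kB ^+ 4 * kappa ^+ 12 / gamma ^+ 3 * lam ^+ H * SW ^+ 2.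
Proof.
apply: (le_trans regret_decomposition); rewrite lerD//.
  rewrite -addrA lerD//.
    by rewrite ler_wpM2r ?diameter_le// invr_ge0 mulr_ge0// ltW.
  set X := C0 ^+ 2 * cY ^+ 2 * cq * Z.
  have X0 : 0 <= X by rewrite mulr_ge0.
  (* C0^2 cY^2 cq contributes 4 * 25 * 4 = 400; the descent takes half of it and the memory term all
     of it, hence 3 / 2 and 600. *)
  have -> : 600 * eta * Gc ^+ 2 * kB ^+ 6 * kappa ^+ 18 * H%:R / gamma ^+ 7 * Z =
      eta * (3 / 2 * (X / gamma)).
    by rewrite /X /C0 /cY /cq; field; rewrite gt_eqF.
  have -> (s1 s2 : R) : eta / 2 * s1 + eta * s2 = eta * (s1 / 2 + s2) by ring.
  rewrite ler_wpM2l ?(ltW eta0)//.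
  have : X <= X / gamma by rewrite ler_peMr.
  have := sum_h2; have := sum_memory; rewrite mulrA -/X; lra.
have E0 : 0 <= 2 * Gc * kappa ^+ 3 * lam ^+ H by rewrite !mulr_ge0 ?exprn_ge0.
(* The constant 90 is 2 * 9 * 5, the 5 coming from [cY]. *)
apply: (@le_trans _ _ (2 * Gc * kappa ^+ 3 * lam ^+ H *
  (9 * kB ^+ 2 * kappa ^+ 3 / gamma * SW) * (cY * SW))).
  apply: ler_pM => //.
  - by rewrite mulr_ge0// !addr_ge0// !mulr_ge0 ?exprn_ge0 ?invr_ge0// ltW.
  - exact: sumr_ge0.
  - by rewrite ler_wpM2l// truncation_factor.
by rewrite /cY expr2 exprS expr2 !invfM; lra.
Qed.

End Comparator.

End Algorithm.

End Deterministic.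

(** * Measurability and Markov's inequality *)

Section Probability.
Context {R : realType} (d : measure_display) (Omega : measurableType d).
Context (P : probability Omega R).

Lemma measurable_vnorm4 n (w : Omega -> 'cV[R]_n) :
  (forall i j, measurable_fun setT (fun om => w om i j)) ->
  measurable_fun setT (fun om => vnorm (w om) ^+ 4).
Proof.
move=> mw; have -> : (fun om => vnorm (w om) ^+ 4) =
    (fun om => (\sum_(i < n) w om i 0 ^+ 2) ^+ 2).
  apply/funext => om; rewrite -[4%N]/(2 * 2)%N exprM sqr_sqrtr//.
  by apply: sumr_ge0 => i _; rewrite sqr_ge0.
by apply: measurable_funX; apply: measurable_sum => i; exact: measurable_funX.
Qed.

Lemma markov_probability (Z : Omega -> R) (a delta : R) :
  measurable_fun setT Z -> (forall om, 0 <= Z om) -> 0 <= a -> 0 < delta ->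
  ('E_P[Z] <= a%:E)%E ->
  measurable [set om | Z om <= a / delta] /\
  ((1 - delta)%:E <= P [set om | (Z om <= a / delta)%R])%E.
Proof.
move=> mZ Z0 a0 d0; rewrite unlock => EZ.
have mE : measurable [set om | Z om <= a / delta].
  have := measurable_fun_le (@measurableT _ Omega) mZ (measurable_cst (a / delta)).
  by rewrite setTI.
split=> //; have mZE : measurable_fun setT (EFin \o Z) by exact/measurable_EFinP.
have normZ : (\int[P]_om `|(EFin \o Z) om| = \int[P]_om (Z om)%:E)%E.
  by apply: eq_integral => om _ /=; rewrite ger0_norm.
suff PC : (P (~` [set om | (Z om <= a / delta)%R]) <= delta%:E)%E.
  move: PC; rewrite probability_setC// EFinB leeBlDr ?fin_num_measure// => h.
  by rewrite leeBlDr// addeC.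
(* At a = 0 the threshold is 0 and Markov's inequality says nothing; instead a vanishing integral
   forces Z = 0 almost everywhere. *)
have [a_eq0|a_neq0] := eqVneq a 0.
  have /(ae_eq_integral_abs P measurableT mZE)[N [mN PN0 subN]] :
      (\int[P]_om `|(EFin \o Z) om| = 0)%E.
    apply/eqP; rewrite eq_le normZ (le_trans EZ) ?a_eq0//=.
    by apply: integral_ge0 => om _; rewrite lee_fin.
  apply: (@le_trans _ _ (P N)); last by rewrite PN0 lee_fin ltW.
  apply: le_measure; rewrite ?inE//; first exact: measurableC.
  apply: subset_trans subN => om /= + Zom0; apply.
  by have [->] := Zom0 I; rewrite a_eq0 mul0r.
have b0 : 0 < a / delta by rewrite divr_gt0// lt_def a_neq0.
have := le_integral_abse P measurableT mZE b0.
rewrite setTI normZ => /le_trans/(_ EZ) h.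
have -> : delta%:E = (((a / delta)^-1)%:E * a%:E)%E.
  by rewrite -EFinM invf_div divfK.
rewrite lee_pdivlMl//; apply: le_trans h; rewrite lee_pmul2l//.
apply: le_measure; rewrite ?inE//.
- exact: measurableC.
- by rewrite -[X in measurable X]setTI; apply: emeasurable_fun_c_infty => //; exact: measurableT_comp.
- by move=> om /= /negP; rewrite -ltNge => /ltW h'; rewrite lee_fin ger0_norm.
Qed.

End Probability.

(** * Constants and horizon *)

Section Horizon.
Context {R : realType}.

(* (6 / 5) ^ 6 < 3 *)
Lemma expR1_le3 : expR 1 <= 3 :> R.
Proof.
have e6 : expR (6^-1) <= 6 / 5 :> R.
  have := expR_ge1Dx (- 6^-1 : R).
  rewrite expRN -(ler_pM2l (expR_gt0 (6^-1 : R))) divff ?gt_eqF ?expR_gt0//; lra.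
have -> : 1 = 6%:R * 6^-1 :> R by rewrite divff.
rewrite expRM_natl; apply: (@le_trans _ _ ((6 / 5) ^+ 6)); last lra.
by rewrite lerXn2r ?nnegrE ?expR_ge0//; lra.
Qed.

Lemma ln_ge1 (T : nat) : (3 <= T)%N -> 1 <= ln (T%:R : R).
Proof.
move=> T3; have T3' : 3 <= T%:R :> R by rewrite ler_nat.
rewrite -ler_expR lnK ?posrE; last by apply: lt_le_trans T3'.
exact: le_trans expR1_le3 T3'.
Qed.

Context (T : nat) (gamma : R) (T3 : (3 <= T)%N) (gamma01 : 0 < gamma < 1).

Let L := ln (T%:R : R).
Let L1 : 1 <= L. Proof. exact: ln_ge1. Qed.
Let g0 : 0 < gamma. Proof. by case/andP: gamma01. Qed.

Let HparE : (Hpar T gamma)%:R = (Num.ceil (2 * gamma^-1 * L))%:~R :> R.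
Proof.
rewrite /Hpar natr_absz ger0_norm// ceil_ge0 (lt_le_trans (ltrN10 _))//.
by rewrite mulr_ge0 ?mulr_ge0 ?invr_ge0 ?(ltW g0)// (le_trans ler01).
Qed.

Lemma Hpar_gt0 : (0 < Hpar T gamma)%N.
Proof.
rewrite -(ltr0n R) HparE; apply: lt_le_trans (ceil_ge _).
by rewrite !mulr_gt0 ?invr_gt0// (lt_le_trans ltr01).
Qed.

(** The unit lost to the ceiling is at most L / gamma, because L >= 1 > gamma. *)
Lemma Hpar_le : (Hpar T gamma)%:R <= 3 * L / gamma.
Proof.
rewrite HparE; have := ceilB1_lt (2 * gamma^-1 * L); rewrite intrB => h.
have Lg : 1 <= L / gamma.
  rewrite ler_pdivlMr// mul1r (le_trans _ L1)// ltW//.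
  by case/andP: gamma01.
lra.
Qed.

(** 1 - gamma <= exp (- gamma) and gamma H >= 2 log T: the 2 in the horizon is the exponent of T. *)
Lemma decay_Hpar : (1 - gamma) ^+ Hpar T gamma <= T%:R ^- 2.
Proof.
have Tp : 0 < T%:R :> R by rewrite ltr0n (leq_trans _ T3).
have l0 : 0 <= 1 - gamma by case/andP: gamma01; lra.
apply: (@le_trans _ _ (expR (- gamma) ^+ Hpar T gamma)).
  by rewrite lerXn2r ?nnegrE ?expR_ge0//; have := expR_ge1Dx (- gamma).
rewrite -expRM_natr -[T%:R]lnK ?posrE// -expRM_natl -expRN ler_expR -/L.
rewrite mulNr lerN2 HparE.
have := ler_wpM2r (ltW g0) (ceil_ge (2 * gamma^-1 * L)).
have -> : 2 * gamma^-1 * L * gamma = 2 * L by field; rewrite gt_eqF.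
lra.
Qed.

End Horizon.

(** * Fitting the pathwise bound into the stated constants *)

Section BoundArithmetic.
Context {R : realType} {nx nu : nat} (B : 'M[R]_(nx, nu)) (kappa gamma Gc sigw delta : R).
Context (T : nat).
Hypotheses (kappa1 : 1 <= kappa) (gamma01 : 0 < gamma < 1) (Gc1 : 1 <= Gc).
Hypotheses (sigw0 : 0 <= sigw) (T3 : (3 <= T)%N) (delta01 : 0 < delta <= 1).

Let L := ln (T%:R : R).
Let sT := Num.sqrt (T%:R : R).
Let kB := kappaB B.
Let n : R := (maxn nx nu)%:R.
Let S := Num.max sigw (sigw ^+ 4).
Let eta := (sT * L ^+ 3)^-1.

Let L1 : 1 <= L. Proof. exact: ln_ge1. Qed.
Let L0 : 0 < L. Proof. exact: lt_le_trans L1. Qed.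
Let g0 : 0 < gamma. Proof. by case/andP: gamma01. Qed.
Let l0 : 0 < 1 - gamma. Proof. by case/andP: gamma01; lra. Qed.
Let d0 : 0 < delta. Proof. by case/andP: delta01. Qed.
Let T0 : 0 < T%:R :> R. Proof. by rewrite ltr0n (leq_trans _ T3). Qed.
Let sT0 : 0 < sT. Proof. by rewrite sqrtr_gt0. Qed.
Let sTE : sT ^+ 2 = T%:R. Proof. by rewrite sqr_sqrtr// ltW. Qed.
Let sT1 : 1 <= sT.
Proof. by rewrite -[1]sqrtr1 ler_wsqrtr// ler1n (leq_trans _ T3). Qed.
Let kB1 : 1 <= kB. Proof. exact: kappaB_ge1. Qed.
Let S0 : 0 <= S. Proof. by rewrite /S le_max sigw0. Qed.
Let S4 : sigw ^+ 4 <= S. Proof. by rewrite /S le_max lexx orbT. Qed.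
Let S2 : sigw ^+ 2 <= S.
Proof.
rewrite /S le_max; have [s1|/ltW s1] := leP sigw 1.
  by rewrite expr2 ler_piMl.
by rewrite ler_weXn2l ?orbT.
Qed.

Let X := Gc ^+ 2 * kB ^+ 6 * kappa ^+ 18.
Let X0 : 0 <= X.
Proof.
by rewrite !mulr_ge0 ?exprn_ge0// (le_trans ler01).
Qed.

Lemma eta_gt0 : 0 < eta.
Proof. by rewrite invr_gt0 mulr_gt0// exprn_gt0. Qed.

Let C := Cdelta B kappa gamma Gc sigw delta.
Let C0 : 0 <= C.
Proof.
have : 0 <= 65 * 1000 + 724 :> R by lra.
(* The numeral is generalized, as unification would unfold it in unary. *)
rewrite /C /Cdelta; move: (65 * 1000 + 724 : R) => N N0.
have kap0 : 0 <= kappa by apply: le_trans kappa1.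
have kB0 : 0 <= kB by apply: le_trans kB1.
apply: divr_ge0; first by rewrite !mulr_ge0 ?exprn_ge0// ltW// (lt_le_trans ltr01).
by rewrite !mulr_ge0 ?exprn_ge0 ?(ltW g0) ?(ltW l0) ?(ltW d0).
Qed.

Lemma regret_bound_ge V : V <= C / 2 * sT * L ->
  16 * nx%:R * kB ^+ 2 * kappa ^+ 6 / gamma ^+ 2 / (2 * eta) + V <=
  regret_bound B kappa gamma Gc sigw delta T.
Proof.
rewrite /regret_bound -/L -/sT -/C; move: C C0 => C' C'0 VC.
have DE : Dconst B kappa gamma ^+ 2 = 16 * n * kB ^+ 2 * kappa ^+ 6 / gamma ^+ 2.
  rewrite /Dconst expr_div_n !exprMn sqr_sqrtr ?ler0n// -/kB -/n; ring.
have nxn : nx%:R <= n by rewrite ler_nat leq_maxl.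
have e1 : 16 * nx%:R * kB ^+ 2 * kappa ^+ 6 / gamma ^+ 2 / (2 * eta) <=
    Dconst B kappa gamma ^+ 2 / 2 * sT * L ^+ 3.
  have -> : (2 * eta)^-1 = sT * L ^+ 3 / 2 by rewrite /eta invfM invrK mulrC.
  rewrite DE.
  have : 0 <= kB ^+ 2 * kappa ^+ 6 / gamma ^+ 2 * (sT * L ^+ 3).
    by rewrite !mulr_ge0 ?invr_ge0 ?exprn_ge0 ?(ltW sT0) ?(ltW L0) ?(ltW g0)// (le_trans ler01).
  by move=> /ler_wpM2l/(_ _ _ nxn); lra.
have e2 : 0 <= 2 * Num.sqrt 3 * Gc * C' ^+ 3 / Num.sqrt gamma * sT * L ^+ 3.
  by rewrite !mulr_ge0 ?invr_ge0 ?sqrtr_ge0 ?exprn_ge0 ?(ltW L0)// (le_trans ler01).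
have e3 : 0 <= 6 * Gc * C' ^+ 2 * L ^+ 2.
  by rewrite !mulr_ge0 ?exprn_ge0 ?(ltW L0)// (le_trans ler01).
lra.
Qed.

(* Everything but the term D ^ 2 / 2 fits into the term C / 2 of the bound; the
   factor T ^- 2 of the truncation errors cancels SW ^ 2, which is at most of
   order T ^ 2. *)
Lemma lower_order_le (H Z SW e : R) : (0 < nx)%N ->
  H <= 3 * L / gamma -> 0 <= Z -> Z <= T%:R * sigw ^+ 4 / delta ->
  0 <= e <= T%:R ^- 2 -> SW ^+ 2 <= T%:R ^+ 2 * sigw ^+ 2 / delta ->
  600 * eta * Gc ^+ 2 * kB ^+ 6 * kappa ^+ 18 * H / gamma ^+ 7 * Z +
  90 * Gc * kB ^+ 4 * kappa ^+ 12 / gamma ^+ 3 * e * SW ^+ 2 <= C / 2 * sT * L.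
Proof.
move=> nx0 HL Z0 Zle /andP[e0 eT] SWle.
have kap0 : 0 <= kappa by apply: le_trans kappa1.
have kB0 : 0 <= kB by apply: le_trans kB1.
have Gc0 : 0 <= Gc by apply: le_trans Gc1.
have n1 : 1 <= n by rewrite ler1n (leq_trans nx0) ?leq_maxl.
pose Q := X * S / (delta * gamma ^+ 8).
have Q0 : 0 <= Q.
  by rewrite divr_ge0 ?mulr_ge0 ?exprn_ge0 ?(ltW d0) ?(ltW g0).
(* The factors n^2 and (1 - gamma)^-4 of [C] are at least 1. Against C / 2 the terms [t1] and [t2]
   require 2 * (1800 + 90) = 3780, within 4000. *)
have QC : 4000 * Q <= C.
  have : 4000 <= 65 * 1000 + 724 :> R by lra.
  rewrite /C /Cdelta; move: (65 * 1000 + 724 : R) => N N4000.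
  apply: (@le_trans _ _ (N * Q)); first by rewrite ler_wpM2r.
  rewrite -/kB -/S -/n [leRHS](_ : _ = N * Q * (n ^+ 2 / (1 - gamma) ^+ 4)).
    have NQ0 : 0 <= N * Q by rewrite mulr_ge0//; lra.
    rewrite ler_peMr//.
    have l4 : (1 - gamma) ^+ 4 <= 1.
      by apply: exprn_ile1; [exact: ltW|rewrite gerBl ltW].
    by apply: mulr_ege1; [exact: exprn_ege1|rewrite invf_ge1// exprn_gt0].
  by rewrite /Q /X; field; rewrite !gt_eqF.
have t1 : 600 * eta * Gc ^+ 2 * kB ^+ 6 * kappa ^+ 18 * H / gamma ^+ 7 * Z <=
    1800 * Q * (sT * L).
  have c0 k : 0 <= k -> 0 <= k * eta * X / gamma ^+ 7.
    move=> k0; rewrite divr_ge0 ?exprn_ge0 ?(ltW g0)//.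
    exact: mulr_ge0 (mulr_ge0 k0 (ltW eta_gt0)) X0.
  have -> : 600 * eta * Gc ^+ 2 * kB ^+ 6 * kappa ^+ 18 * H / gamma ^+ 7 * Z =
    600 * eta * X / gamma ^+ 7 * (H * Z) by rewrite /X; ring.
  have HZ : H * Z <= 3 * L / gamma * (T%:R * S / delta).
    have r0 : 0 <= 3 * L / gamma by rewrite divr_ge0 ?mulr_ge0 ?(ltW L0) ?(ltW g0).
    apply: (le_trans (ler_wpM2r Z0 HL)); rewrite ler_wpM2l//.
    apply: (le_trans Zle); rewrite ler_wpM2r ?invr_ge0 ?(ltW d0)//.
    by rewrite ler_wpM2l// ltW.
  apply: (le_trans (ler_wpM2l (c0 _ (ler0n _ 600)) HZ)).
  (* Here eta T = sT / L^3, and the horizon gives back one [L]. *)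
  have -> : 600 * eta * X / gamma ^+ 7 * (3 * L / gamma * (T%:R * S / delta)) =
     1800 * Q * (sT / L ^+ 2).
    by rewrite /Q /eta -sTE; field; rewrite !gt_eqF.
  apply: ler_wpM2l; first exact: mulr_ge0 (ler0n _ _) Q0.
  apply: ler_wpM2l; first exact: ltW.
  by apply: le_trans L1; rewrite invf_le1 ?exprn_gt0// exprn_ege1.
have t2 : 90 * Gc * kB ^+ 4 * kappa ^+ 12 / gamma ^+ 3 * e * SW ^+ 2 <= 90 * Q * (sT * L).
  have eS : e * SW ^+ 2 <= S / delta.
    apply: (@le_trans _ _ (T%:R ^- 2 * (T%:R ^+ 2 * sigw ^+ 2 / delta))).
      by rewrite ler_pM// sqr_ge0.
    have -> : T%:R ^- 2 * (T%:R ^+ 2 * sigw ^+ 2 / delta) = sigw ^+ 2 / delta.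
      by field; rewrite !gt_eqF.
    by rewrite ler_wpM2r ?invr_ge0 ?(ltW d0).
  have c1 : Gc * kB ^+ 4 * kappa ^+ 12 <= X.
    apply: ler_pM; rewrite ?mulr_ge0 ?exprn_ge0 ?ler_weXn2l//.
    apply: ler_pM; rewrite ?exprn_ge0 ?ler_weXn2l//.
    by rewrite expr2 ler_peMl.
  have c2 : gamma ^- 3 <= gamma ^- 8.
    rewrite lef_pV2 ?posrE ?exprn_gt0// ler_wiXn2l// ?(ltW g0)//.
    by case/andP: gamma01 => _ /ltW.
  have c3 : Gc * kB ^+ 4 * kappa ^+ 12 / gamma ^+ 3 <= X / gamma ^+ 8.
    by rewrite ler_pM ?mulr_ge0 ?invr_ge0 ?exprn_ge0 ?(ltW g0).
  have := ler_pM _ _ c3 eS => /(_ _ _)/le_trans.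
  have -> : 90 * Gc * kB ^+ 4 * kappa ^+ 12 / gamma ^+ 3 * e * SW ^+ 2 =
    90 * (Gc * kB ^+ 4 * kappa ^+ 12 / gamma ^+ 3 * (e * SW ^+ 2)) by ring.
  move=> h; rewrite -[leRHS]mulrA; apply: ler_wpM2l (ler0n _ _) _ _ _; apply: h.
  - by rewrite !mulr_ge0 ?invr_ge0 ?exprn_ge0 ?(ltW g0).
  - by rewrite mulr_ge0 ?sqr_ge0.
  have -> : X / gamma ^+ 8 * (S / delta) = Q.
    by rewrite /Q; field; rewrite !gt_eqF.
  by rewrite ler_peMr// mulr_ege1.
have sL : 0 <= sT * L by rewrite mulr_ge0 ?(ltW sT0) ?(ltW L0).
have := ler_wpM2r sL QC; move: C => C'; have : 0 <= Q * (sT * L) by rewrite mulr_ge0.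
lra.
Qed.

Lemma C_term_ge0 : 0 <= C / 2 * sT * L.
Proof. by move: C C0 => C' C'0; rewrite !mulr_ge0 ?(ltW sT0) ?(ltW L0). Qed.

End BoundArithmetic.

(** Cauchy-Schwarz twice: (\sum W)^4 <= T^3 \sum W^4 <= T^4 s^4 / delta. The square root would give
    delta^(-1/2), weakened to 1 / delta since delta <= 1. *)
Lemma sum_le_fourth_moment (R : realType) (T : nat) (W : nat -> R) (s delta : R) :
  0 < delta <= 1 -> (forall t, 0 <= W t) ->
  \sum_(t < T) W t ^+ 4 <= T%:R * s ^+ 4 / delta ->
  (\sum_(t < T) W t) ^+ 2 <= T%:R ^+ 2 * s ^+ 2 / delta.
Proof.
move=> /andP[d0 d1] W0 WZ.
have cs (F : nat -> R) : (\sum_(t < T) F t) ^+ 2 <= T%:R * \sum_(t < T) F t ^+ 2.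
  have := ler_sum_sqr (index_enum 'I_T) (fun=> 1) (fun t : 'I_T => F t).
  under eq_bigr do rewrite mul1r.
  under [X in _ <= X * _]eq_bigr do rewrite expr1n.
  by rewrite sumr_const card_ord.
have sumW2_ge0 : 0 <= \sum_(t < T) W t ^+ 2 by apply: sumr_ge0 => t _; rewrite sqr_ge0.
rewrite -(@ler_pXn2r _ 2)// ?nnegrE ?sqr_ge0//; last first.
  by rewrite divr_ge0 ?(ltW d0)// mulr_ge0 ?sqr_ge0.
apply: (@le_trans _ _ ((T%:R * \sum_(t < T) W t ^+ 2) ^+ 2)).
  by rewrite lerXn2r ?nnegrE ?sqr_ge0 ?mulr_ge0.
rewrite exprMn; apply: (@le_trans _ _ (T%:R ^+ 2 * (T%:R * (T%:R * s ^+ 4 / delta)))).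
  rewrite ler_wpM2l ?sqr_ge0//; apply: (le_trans (cs (fun t => W t ^+ 2))).
  by under eq_bigr do rewrite -exprM; rewrite ler_wpM2l.
have -> : T%:R ^+ 2 * (T%:R * (T%:R * s ^+ 4 / delta)) =
   (T%:R ^+ 2 * s ^+ 2) ^+ 2 / delta by ring.
rewrite expr_div_n ler_wpM2l ?sqr_ge0// lef_pV2 ?posrE ?exprn_gt0//.
by rewrite expr2 ler_piMl// ltW.
Qed.

Unset Implicit Arguments. Set Strict Implicit. Set Printing Implicit Defensive.

Theorem theorem1 (R : realType) (d : measure_display) (Omega : measurableType d)
  (P : probability Omega R) (nx nu : nat)
  (A : 'M[R]_nx) (B : 'M[R]_(nx, nu)) (kappa gamma : R) (K : 'M[R]_(nu, nx))
  (c : nat -> 'cV[R]_nx -> 'cV[R]_nu -> R) (Gc sigw : R)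
  (w : nat -> Omega -> 'cV[R]_nx) (T : nat) (delta : R)
  (M0 : 'M[R]_(nu, Hpar T gamma * nx)) :
  1 <= kappa -> 0 < gamma < 1 ->
  (* Assumption A1 *)
  assumption_A1 c Gc ->
  (* the noise is a stochastic process (entrywise measurable) *)
  (forall t (i : 'I_nx) (j : 'I_1), measurable_fun setT (fun om => w t om i j)) ->
  (* Assumption A2(ii) *)
  0 <= sigw ->
  (forall t, ('E_P[(fun om => vnorm (w t om) ^+ 4)%R] <= (sigw ^+ 4)%:E)%E) ->
  (* the minimum in the definition of Regret_T is attained *)
  (forall om, exists Ks, strongly_stable A B kappa gamma Ks /\
     forall K', strongly_stable A B kappa gamma K' ->
       J_lin A B Ks c (fun t => w t om) T <= J_lin A B K' c (fun t => w t om) T) ->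
  strongly_stable A B kappa gamma K ->
  inM B kappa gamma M0 ->
  (3 <= T)%N -> 0 < delta <= 1 ->
  exists E : set Omega, measurable E /\ ((1 - delta)%:E <= P E)%E /\
    forall om, E om ->
      regret A B K kappa gamma (Num.sqrt (T%:R) * ln (T%:R : R) ^+ 3)^-1 c
        (fun t => w t om) M0 T
      <= regret_bound B kappa gamma Gc sigw delta T.
Proof.
move=> kappa1 gamma01 cA1 mw sigw0 Ew minJ Kst M0in T3 delta01.
have [Gc1 _ _ _] := cA1; have /andP[d0 _] := delta01.
pose Z om := \sum_(t < T) vnorm (w t om) ^+ 4.
have mZt t : measurable_fun setT (fun om => vnorm (w t om) ^+ 4).
  exact: measurable_vnorm4.
have vnorm4_ge0 t om : 0 <= vnorm (w t om) ^+ 4 by rewrite exprn_ge0// sqrtr_ge0.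
have EZ : ('E_P[Z] <= (T%:R * sigw ^+ 4)%:E)%E.
  rewrite unlock; under eq_integral do rewrite /Z -sumEFin.
  rewrite ge0_integral_sum//=; last 2 first.
  - by move=> t; exact/measurable_EFinP.
  - by move=> t om _; rewrite lee_fin.
  have -> : (T%:R * sigw ^+ 4)%:E = (\sum_(t < T) (sigw ^+ 4)%:E)%E.
    by rewrite sumEFin sumr_const card_ord mulr_natl.
  by apply: lee_sum => t _; have := Ew t; rewrite unlock.
have mZ : measurable_fun setT Z by exact: measurable_sum.
have Z0 om : 0 <= Z om by exact: sumr_ge0.
have m0 : 0 <= T%:R * sigw ^+ 4 by rewrite mulr_ge0 ?exprn_ge0.
have [mE PE] := markov_probability mZ Z0 m0 d0 EZ.
exists [set om | Z om <= T%:R * sigw ^+ 4 / delta]; split=> //; split=> // om Zle.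
(* The minimizing policy may depend on [om]: the pathwise bound holds for every comparator, so no
   measurable selection is involved. *)
set v := fun t => w t om; have [Ks [Ksst Ksmin]] := minJ om.
have infE : inf [set J_lin A B K' c v T | K' in
    [set K' | strongly_stable A B kappa gamma K']] = J_lin A B Ks c v T.
  apply/eqP; rewrite eq_le; apply/andP; split.
    apply: ge_inf; last by exists Ks.
    by exists (J_lin A B Ks c v T) => _ [K' K'st <-]; exact: Ksmin.
  by apply: lb_le_inf => [|_ [K' K'st <-]]; [exists (J_lin A B Ks c v T), Ks|exact: Ksmin].
rewrite /regret infE.
have H0 := Hpar_gt0 T3 gamma01.
have eta0 := @eta_gt0 R T T3.
apply: le_trans (dap_regret_le v kappa1 gamma01 cA1 Kst T eta0 M0in Ksst H0) _.
rewrite -addrA; apply: regret_bound_ge => //.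
have ZE : \sum_(t < T) frobn (v t) ^+ 4 = Z om.
  by apply: eq_bigr => t _; rewrite vnormE.
(* [lower_order_le] divides out n^2 >= 1, which could fail for nx = 0; in that case the noise has
   norm 0 and the lower-order terms vanish. *)
have [nx_gt0|] := ltnP 0 nx.
  apply: lower_order_le => //.
  - exact: Hpar_le.
  - by rewrite ZE.
  - by rewrite ZE.
  - rewrite decay_Hpar// exprn_ge0// subr_ge0 ltW//.
    by case/andP: gamma01.
  - apply: (@sum_le_fourth_moment R T (fun t => frobn (v t)) sigw delta delta01).
      by move=> t; exact: frobn_ge0.
    by rewrite ZE.
rewrite leqn0 => /eqP nx0.
have v0 t : frobn (v t) = 0.
  rewrite -vnormE /vnorm big1 ?sqrtr0// => i _.
  by have := ltn_ord i; rewrite [X in (_ < X)%N]nx0.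
rewrite !big1 => [|t _|t _]; rewrite ?v0 ?expr0n//=.
by rewrite !mulr0 addr0 C_term_ge0.
Qed.
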